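(* Let $d\colon\mathcal{X}\times\mathcal{X}\to[0,1]$ be a normalized distance, let $m,M\in(0,1)$ with $m\le M$, and let $\mathcal{S}$ be the outlier-score suppression algorithm, which independently deletes each record $x\in D$ with probability $\mathrm{out}_D(x)$, i.e. \[ \Pr\{\mathcal{S}(D)=C\}=\prod_{x\in C}(1-\mathrm{out}_D(x))\prod_{x\in D\setminus C}\mathrm{out}_D(x) \] for all $D\in\mathcal{D}$ and all $C\subseteq D$. If $\mathcal{M}$ with domain $\mathcal{D}$ is unbounded $(\varepsilon,\delta)$-DP, then $\mathcal{M}\circ\mathcal{S}$ is unbounded $(\varepsilon^{\mathcal{S}},\delta^{\mathcal{S}})$-DP with $\delta^{\mathcal{S}}=\delta(1-m)$ and $\varepsilon^{\mathcal{S}}$ equal, up to an error of $2\cdot10^{-7}$, to \[ \max_{p\in[0,1]}\max\{l_1(p),l_2(p),l_3\}, \] where \[ l_1(p)=\ln\big(e^{\varepsilon}-(e^{\varepsilon}-1)(pM+(1-p)m)\big)+p\frac{M}{m}+(1-p)\frac{1-m}{1-(pM+(1-p)m)}-1, \] \[ l_2(p)=\ln\Big(e^{\varepsilon}-(e^{\varepsilon}-1)\Big(pM+(1-p)\frac{(M+m)-pM}{2-p}\Big)\Big)+p\frac{M}{m}+(1-p)\frac{1-\frac{(M+m)-pM}{2-p}}{1-M}-1, \] \[ l_3=-\ln\big(e^{-\varepsilon}+(1-e^{-\varepsilon})M\big)+1-\frac{1-M}{1-m}. \]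
   Context: Let $\mathcal{X}$ be a set and $\mathcal{D}$ a class of finite multisets of elements of $\mathcal{X}$ (databases), closed under taking sub-multisets. Two databases are (unbounded) neighboring if one is obtained from the other by adding exactly one record. A randomized mechanism $\mathcal{M}$ with domain $\mathcal{D}$ (outputs in a measurable space $\mathcal{R}$) is unbounded $(\varepsilon,\delta)$-DP if for all neighboring $D,D'\in\mathcal{D}$ (either order) and all measurable $E\subseteq\mathcal{R}$, $\Pr\{\mathcal{M}(D)\in E\}\le e^{\varepsilon}\Pr\{\mathcal{M}(D')\in E\}+\delta$. A suppression algorithm $\mathcal{S}$ assigns to each $D$ a discrete random variable $\mathcal{S}(D)$ taking sub-multisets of $D$ as values; $\mathcal{M}\circ\mathcal{S}$ is $D\mapsto\mathcal{M}(\mathcal{S}(D))$ with independent randomness. A normalized distance is a metric $d$ on $\mathcal{X}$ with values in $[0,1]$ and $\sup_{x,y}d(x,y)=1$. Its $(m,M)$-transformation is $\tilde d(x,y)=m+(M-m)d(x,y)\in[m,M]$. For non-empty $D\in\mathcal{D}$ and $x\in D$, the outlier score is $\mathrm{out}_D(x)=\frac{1}{|D|}\sum_{y\in D}\tilde d(x,y)$ (sum with multiplicity); for $D=\varnothing$, $\mathcal{S}(\varnothing)=\varnothing$. *)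

(* Defs.v *)
From HB Require Import structures.
From mathcomp Require Import all_boot all_order all_algebra.
From mathcomp Require Import all_classical all_reals all_analysis.
From Stdlib Require Permutation.

Set Implicit Arguments.
Unset Strict Implicit.
Unset Printing Implicit Defensive.

Import Order.TTheory GRing.Theory Num.Theory.
Local Open Scope ring_scope.

(* Databases are finite multisets of records of X, represented as lists
   up to permutation ([Permutation.Permutation]).  Records of a database are
   identified by their position in the list. *)

Section DP_defs.
Context {R : realType} {X : Type}.

Definition is_normalized_distance (d : X -> X -> R) : Prop :=
  [/\ (forall x y, 0 <= d x y /\ d x y <= 1),
      (forall x y, d x y = 0 <-> x = y),
      (forall x y, d x y = d y x),
      (forall x y z, d x z <= d x y + d y z) &
      (forall e, 0 < e -> exists x y, 1 - e < d x y)].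

Definition mtrans (m M : R) (d : X -> X -> R) (x y : X) : R :=
  m + (M - m) * d x y.

Definition out_score (m M : R) (d : X -> X -> R) (D : seq X) (x : X) : R :=
  (size D)%:R^-1 * \sum_(y <- D) mtrans m M d x y.

(* Probability that the outlier-score suppression algorithm keeps exactly the
   records selected by the bit mask b (b_i = true : record i kept):
   prod_{kept} (1 - out_D(x)) * prod_{deleted} out_D(x). *)
Definition supp_weight (m M : R) (d : X -> X -> R) (D : seq X) (b : seq bool) : R :=
  \prod_(p <- zip b D)
     (if p.1 then 1 - out_score m M d D p.2 else out_score m M d D p.2).

Definition neighbor (D D' : seq X) : Prop :=
  exists x, Permutation.Permutation D' (x :: D).

Definition unbounded_DP {dT : measure_display} {T : measurableType dT}
  (Dom : seq X -> Prop) (P : seq X -> set T -> \bar R) (eps delta : R) : Prop :=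
  forall D D', Dom D -> Dom D' -> (neighbor D D' \/ neighbor D' D) ->
  forall E, measurable E ->
    (P D E <= (expR eps)%:E * P D' E + delta%:E)%E.

Definition comp_supp {dT : measure_display} {T : measurableType dT}
  (m M : R) (d : X -> X -> R) (Mech : seq X -> probability T R)
  (D : seq X) (E : set T) : \bar R :=
  (\sum_(b : (size D).-tuple bool)
      (supp_weight m M d D b)%:E * Mech (mask b D) E)%E.

End DP_defs.

Section Bounds.
Context {R : realType}.
Variables (eps m M : R).

Definition l1 (p : R) : R :=
  ln (expR eps - (expR eps - 1) * (p * M + (1 - p) * m))
  + p * (M / m) + (1 - p) * ((1 - m) / (1 - (p * M + (1 - p) * m))) - 1.

Definition l2 (p : R) : R :=
  let q := ((M + m) - p * M) / (2 - p) in
  ln (expR eps - (expR eps - 1) * (p * M + (1 - p) * q))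
  + p * (M / m) + (1 - p) * ((1 - q) / (1 - M)) - 1.

Definition l3 : R :=
  - ln (expR (- eps) + (1 - expR (- eps)) * M) + 1 - (1 - M) / (1 - m).

Definition lmax (p : R) : R := Num.max (Num.max (l1 p) (l2 p)) l3.

End Bounds.

(* Main.v *)
Require Import Defs.
From HB Require Import structures.
From mathcomp Require Import all_boot all_order all_algebra.
From mathcomp Require Import all_classical all_reals all_analysis.
From mathcomp Require Import ring lra.
From Stdlib Require Permutation.

Import Order.TTheory GRing.Theory Num.Theory.
Import numFieldNormedType.Exports.
Local Open Scope ring_scope.

(** The value V itself works as privacy parameter.  Let D' = D + z, N = |D|,
lam = N / (N + 1), and let s x, s' x be the outlier scores of x in D and D',
so that s' = lam * s + (1 - lam) * t with t the transformed distance to z.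
Conditioning on whether z is deleted costs the factor e - (e - 1) * s' z
(adding z) or 1 / (b + (1 - b) * s' z) (removing z), where e = exp eps and
b = 1 / e; their logarithms are [logA] and [logB].  The remaining records
cost a product of ratios of kept/deleted probabilities, and 1 + x <= exp x
bounds its logarithm by a mean over D of a function of t.  The triangle
inequality confines s and s' to a band around t, and an affine majorant
alpha + beta * t of that function turns the mean into its value at the mean
of t, which is tied to s' z.

Adding z: the optimal majorant is a chord through two of the three points
t = m, t = M and the kink of the function; these chords give l1 and l2.
Removing z: if (M - m) / (1 - m) >= 3/4, the bound is below l2 at p = 0.
Otherwise [logB] <= [logA] reduces it to l1 when m <= 1/2.  When m >= 1/2,
either the slope of [logB] is small enough to move to l3, or eps is bounded
below, and then the gap [logA] - [logB] suffices for l1 or for l2 at p = 0. *)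

(** * Elementary bounds on the logarithm *)

Lemma ln_sub_le (R : realType) (x y : R) : 0 < x -> 0 < y ->
  ln x - ln y <= (x - y) / y.
Proof.
move=> x0 y0; rewrite -ln_div ?posrE//.
have -> : x / y = 1 + (x - y) / y by field; rewrite gt_eqF.
apply: le_ln1Dx; rewrite mulrBl divff ?gt_eqF//.
have : 0 < x / y by exact: divr_gt0.
lra.
Qed.

(** The difference of the two sides vanishes at 1 and has derivative [(1 - x^-1)^2 / 2]. *)
Lemma ln_le_half_sub_inv (R : realType) (y : R) : 1 <= y -> ln y <= (y - y^-1) / 2.
Proof.
move=> y1; pose f (x : R) := (x - x^-1) / 2 - ln x.
have df (x : R) : 1 <= x -> is_derive x 1 (f : R -> R) ((1 + x ^- 2) / 2 - x^-1).
  move=> x1; have x0 : 0 < x by lra.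
  have xn0 : x != 0 by rewrite gt_eqF.
  have dinv : is_derive x 1 (fun t : R => t^-1) (- x ^- 2 *: 1).
    exact: (@is_deriveV _ id x 1 1 xn0 (is_derive_id _ _)).
  have dln := is_derive1_ln x0.
  rewrite (_ : f = 2^-1 \*: (id - (fun t : R => t^-1)) - @ln R :> (R -> R)); last first.
    by apply/funext => t; rewrite /f mulrC.
  apply: is_derive_eq.
  by rewrite /GRing.scale/=; field; exact: xn0.
suff : f 1 <= f y by rewrite /f ln1 invr1; lra.
apply: (@ger0_derive1_ndecr _ f 1 y) => //.
- move=> x; rewrite in_itv/= => /andP[x1 _].
  by have [] := df x (ltW x1).
- move=> x; rewrite in_itv/= => /andP[x1 _].
  rewrite derive1E; have [_ ->] := df x (ltW x1).
  rewrite -exprVn.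
  have := sqr_ge0 (1 - x^-1); lra.
- apply: derivable_within_continuous => x; rewrite in_itv/= => /andP[x1 _].
  by have [] := df x x1.
Qed.

(** * Adding a record: the factor of z and the choice of the majorant *)

Definition logA {R : realType} (e T : R) : R := ln (e - (e - 1) * T).
Definition logB {R : realType} (e T : R) : R := - ln (e^-1 + (1 - e^-1) * T).

(** The argument of the logarithm at [T'] is [1 + (e - 1) * (1 - T')]; it exceeds
    [(e - 1) * (1 - T')], so [e] cancels from the tangent bound. *)
Lemma logA_sub_le (R : realType) (e T T' : R) :
  1 <= e -> T <= T' -> T' < 1 -> logA e T - logA e T' <= (T' - T) / (1 - T').
Proof.
move=> e1 TT' T'1.
have h0 : 0 <= (e - 1) * (1 - T') by apply: mulr_ge0; lra.
have h1 : 0 <= (e - 1) * (T' - T) by apply: mulr_ge0; lra.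
have q0 : 0 < e - (e - 1) * T' by nra.
apply: le_trans (ln_sub_le _ _ _ _ _) _ => //; first by nra.
rewrite ler_pdivrMr// mulrAC ler_pdivlMr; last by lra.
have : 0 <= (T' - T) * (1 - (e - 1) * T' + e - 1 - (e - 1) * (1 - T')).
  apply: mulr_ge0; nra.
nra.
Qed.

(* alpha + beta * u majorizes the ratio at distance t = m + u; the three
   conditions are those at u = 0, at the kink u = M - m - y and at u = M - m. *)
Lemma logA_bound (R : realType) (m M e V lam z : R) :
  0 < m -> m <= M -> M < 1 -> 1 <= e -> 0 <= lam -> lam <= 1 -> 0 <= z -> z <= 1 ->
  (forall p, 0 <= p -> p <= 1 ->
     logA e (m + p * (M - m)) + p * ((M - m) / m)
       + (1 - p) * (p * (M - m) / (1 - m - p * (M - m))) <= V) ->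
  (forall p, 0 <= p -> p <= 1 ->
     logA e (m + (M - m) / (2 - p)) + p * ((M - m) / m)
       + (1 - p) * ((M - m) / (2 - p) / (1 - M)) <= V) ->
  let y := z * (M - m) in
  exists alpha beta : R,
    [/\ y / (1 - m - y) <= alpha, y / (1 - M) <= alpha + beta * (M - m - y),
        (M - m) / m <= alpha + beta * (M - m) &
        logA e (m + lam * y) + lam * (alpha + beta * y) <= V].
Proof.
move=> m0 mM M1 e1 l0 l1 z0 z1 H1 H2 y.
set D := M - m in H1 H2 y *.
have [D0|Dn0] := eqVneq D 0.
  exists 0, 0; rewrite /y D0 !(mulr0, mul0r, addr0); split => //.
  have := H1 0 (lexx _) ler01.
  by rewrite D0 !(mulr0, mul0r, addr0).
have Dp : 0 < D by rewrite lt_def Dn0 /D subr_ge0.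
have y0 : 0 <= y by apply: mulr_ge0 => //; exact: ltW.
have yD : y <= D by rewrite /y; nra.
have cD : 1 - m - D = 1 - M by rewrite /D; ring.
have cy : 0 < 1 - m - y by lra.
have cM : 0 < 1 - M by lra.
set P0 := y / (1 - m - y); set Pq := y / (1 - M); set P1 := D / m.
have P0q : P0 <= Pq.
  by rewrite /P0 /Pq ler_wpM2l// lef_pV2 ?posrE//; lra.
have P00 : 0 <= P0 by apply: divr_ge0 => //; exact: ltW.
have P10 : 0 <= P1 by apply: divr_ge0; exact: ltW.
have yE : y = z * D by [].
have P0E : P0 = y / (1 - m - y) by [].
have PqE : Pq = y / (1 - M) by [].
have P1E : P1 = D / m by [].
clearbody P1 Pq P0 y D.
have l1' : 0 <= 1 - lam by rewrite subr_ge0.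
(* As [x] grows, [logA] falls at a rate of at most [D / (1 - M)], so the left side increases up to
   [x = 1/2], where it is l2 at [p = 0]. *)
have A0 x : 0 <= x -> x <= 1/2 -> logA e (m + x * D) + x * D / (1 - M) <= V.
  move=> x0 x1; apply: le_trans (H2 0 (lexx _) ler01).
  rewrite subr0 mul0r addr0 subr0 mul1r.
  have T1 : m + D / 2 < 1 by lra.
  have TT : m + x * D <= m + D / 2 by nra.
  have := logA_sub_le _ _ _ _ e1 TT T1.
  have : (m + D / 2 - (m + x * D)) / (1 - (m + D / 2)) <= (D / 2 - x * D) / (1 - M).
    rewrite (_ : m + D / 2 - (m + x * D) = D / 2 - x * D); last by ring.
    rewrite ler_wpM2l ?lef_pV2 ?posrE ?subr_gt0//.
      by clear -x1 Dp; nra.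
    by clear -cD Dp; lra.
  by rewrite mulrBl; clear; lra.
(* The kink is at [u = (1 - z) * D]. If the chord through the end points passes above it, that chord
   is the majorant, and l1 at [p = lam * z] bounds the total. *)
have [Hc|Hc] := leP Pq (P0 + (P1 - P0) * (1 - z)).
  exists P0, ((P1 - P0) / D); split => //.
  - by rewrite (_ : _ * _ = (P1 - P0) * (1 - z)) // yE; field.
  - by rewrite divfK//; lra.
  - have -> : (P1 - P0) / D * y = (P1 - P0) * z by rewrite yE; field.
    have lz0 : 0 <= lam * z by apply: mulr_ge0.
    have lz1 : lam * z <= 1 by nra.
    apply: le_trans (H1 _ lz0 lz1).
    rewrite -P1E (_ : lam * z * D = lam * y); last by rewrite yE; ring.
    have ly : lam * y <= y by rewrite ler_piMl.
    have cly : 0 < 1 - m - lam * y by clear -ly cy; lra.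
    suff : lam * (1 - z) * P0 <= (1 - lam * z) * (lam * y / (1 - m - lam * y)) by clear; lra.
    have -> : lam * (1 - z) * P0 = lam * y * ((1 - z) / (1 - m - y)).
      by rewrite P0E; ring.
    rewrite [leRHS]mulrCA ler_wpM2l//; first exact: mulr_ge0.
    rewrite ler_pdivrMr// mulrAC ler_pdivlMr//.
    have : 0 <= (1 - lam) * z * (1 - m - D) by rewrite !mulr_ge0// cD ltW.
    by rewrite yE; clear; lra.
(* Kink above that chord, [z <= 1/2]: the chord through [u = 0] and the kink is taken. The mean
   [u = y] is not to the right of the kink, so the value there is at most [Pq]. *)
have [zh|zh] := leP z (1/2).
  have Dy : 0 < D - y by rewrite yE; clear -zh Dp; nra.
  have Dyn : D - y != 0 by rewrite gt_eqF.
  exists P0, ((Pq - P0) / (D - y)); split => //.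
  - by rewrite divfK//; clear; lra.
  - rewrite -lerBlDl mulrAC ler_pdivlMr//.
    rewrite (_ : D - y = (1 - z) * D); last by rewrite yE; ring.
    by rewrite mulrA ler_wpM2r ?(ltW Dp)//; clear -Hc; lra.
  - have hq : P0 + (Pq - P0) / (D - y) * y <= Pq.
      rewrite -lerBrDl mulrAC ler_pdivrMr// ler_wpM2l ?subr_ge0//.
      by rewrite yE; clear -zh Dp; nra.
    have lz0 : 0 <= lam * z by apply: mulr_ge0.
    have lz1 : lam * z <= 1/2 by apply: le_trans zh; rewrite ler_piMl.
    have := A0 _ lz0 lz1; rewrite (_ : lam * z * D = lam * y); last by rewrite yE; ring.
    have : lam * (P0 + (Pq - P0) / (D - y) * y) <= lam * Pq by rewrite ler_wpM2l.
    by rewrite PqE -[lam * y / _]mulrA; clear; lra.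
have zp : 0 < z by clear -zh; lra.
have zn : z != 0 by rewrite gt_eqF.
have yp : 0 < y by rewrite yE mulr_gt0.
have yn : y != 0 by rewrite gt_eqF.
pose i := z^-1.
have iz : i * z = 1 by rewrite /i mulVf.
have i2 : i <= 2 by clear -iz zh zp; nra.
have i1 : 1 <= i by clear -iz z1 zp; nra.
(* For [z > 1/2] the chord through the kink and [u = D] is taken. [X] is its value at [u = y], and
   l2 at [p = 2 - z^-1] equals [logA e (m + y) + X]. *)
set X := (2 - i) * P1 + (i - 1) * Pq.
exists (P1 - (P1 - Pq) / y * D), ((P1 - Pq) / y).
have yD' : (P1 - Pq) / y * D = (P1 - Pq) * i by rewrite /i yE; field; apply/andP.
split.
- rewrite yD'.
  have : (P1 - Pq) * i <= (z * (P1 - P0)) * i.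
    by rewrite ler_wpM2r//; [clear -i1; lra|clear -Hc; lra].
  rewrite mulrAC [z * i]mulrC iz mul1r; clear; lra.
- by rewrite [_ / y * (D - y)]mulrBr (divfK yn); clear; lra.
- by rewrite subrK.
rewrite yD' divfK//.
have -> : P1 - (P1 - Pq) * i + (P1 - Pq) = X by rewrite /X; ring.
have i2' : 0 <= 2 - i by rewrite subr_ge0.
have i1' : 0 <= i - 1 by rewrite subr_ge0.
have D2p : D / (2 - (2 - i)) = y.
  rewrite (_ : 2 - (2 - i) = i); last by ring.
  by rewrite /i invrK mulrC.
(* This condition gives [Pq <= P1], so [X] outweighs the decrease of [logA] in [lam], and [lam = 1]
   is the worst case. *)
have [hm|hm] := leP (m * z) (1 - M).
  have Pq1 : Pq <= P1.
    by rewrite PqE P1E ler_pdivrMr// mulrAC ler_pdivlMr// yE; clear -hm Dp; nra.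
  have XP : Pq <= X by rewrite /X; clear -Pq1 i2'; nra.
  have p0 : 0 <= 2 - i by [].
  have p1 : 2 - i <= 1 by clear -i1; lra.
  have := H2 _ p0 p1; rewrite D2p -P1E -PqE.
  have T1 : m + y < 1 by clear -cy; lra.
  have TT : m + lam * y <= m + y by rewrite lerD2l ler_piMl.
  have := logA_sub_le _ _ _ _ e1 TT T1.
  have -> : (m + y - (m + lam * y)) / (1 - (m + y)) = (1 - lam) * P0.
    by rewrite P0E [RHS]mulrA; congr (_ / _); ring.
  have : (1 - lam) * P0 <= (1 - lam) * X by rewrite ler_wpM2l// (le_trans P0q).
  by rewrite /X; clear; lra.
have P1q : P1 * i <= D / (1 - M).
  rewrite P1E -!mulrA ler_wpM2l ?(ltW Dp)// /i -invfM lef_pV2 ?posrE//; last exact: mulr_gt0.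
  exact: ltW.
have Pqi : Pq * i = D / (1 - M).
  by rewrite PqE yE mulrAC [_ * i]mulrAC [z * i]mulrC iz mul1r.
have [lh|lh] := leP (lam * z) (1/2).
  have lz0 : 0 <= lam * z by apply: mulr_ge0.
  have := A0 _ lz0 lh; rewrite (_ : lam * z * D = lam * y); last by rewrite yE; ring.
  have PP : P1 <= Pq.
    have ip : 0 < i by clear -i1; lra.
    by rewrite -(ler_pM2r ip) Pqi.
  have : lam * X <= lam * Pq by rewrite ler_wpM2l// /X; clear -PP i2'; nra.
  by rewrite PqE -[lam * y / _]mulrA; clear; lra.
have lp : 0 < lam by clear -lh l0 z0 z1; nra.
have ln0 : lam != 0 by rewrite gt_eqF.
(* Here l2 is used at [p = 2 - (lam * z)^-1], which makes its argument of [logA] equal to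
   [m + lam * y]. *)
pose j := (lam * z)^-1.
have jz : j * (lam * z) = 1 by rewrite /j mulVf// mulf_neq0.
have jl : j * lam = i.
  by rewrite /j /i; field; apply/andP.
have lzp : 0 < lam * z by rewrite mulr_gt0.
have lz1 : lam * z <= 1 by rewrite mulr_ile1.
have j2 : j <= 2 by clear -jz lzp lh; nra.
have j1 : 1 <= j by clear -jz lzp lz1; nra.
have p0 : 0 <= 2 - j by rewrite subr_ge0.
have p1 : 2 - j <= 1 by clear -j1; lra.
have := H2 _ p0 p1.
have -> : D / (2 - (2 - j)) = lam * y.
  rewrite (_ : 2 - (2 - j) = j); last by ring.
  by rewrite /j invrK yE; ring.
rewrite -P1E -[lam * y / _]mulrA -PqE.
suff : lam * X <= (2 - j) * P1 + (1 - (2 - j)) * (lam * Pq) by clear; lra.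
have h1 : 0 <= (1 - lam) * (Pq * i - P1 * i) by rewrite mulr_ge0// subr_ge0 Pqi.
have h2 : 0 <= (1 - lam) * ((2 - j) * P1) by rewrite !mulr_ge0.
rewrite /X -subr_ge0.
have -> : (2 - j) * P1 + (1 - (2 - j)) * (lam * Pq) - lam * ((2 - i) * P1 + (i - 1) * Pq)
  = (1 - lam) * (Pq * i - P1 * i) + (1 - lam) * ((2 - j) * P1)
    + (j * lam - i) * (Pq - P1) by ring.
by rewrite jl subrr mul0r addr0 addr_ge0.
Qed.

(** * Polynomial inequalities for the gap between [logA] and [logB] *)

Lemma far_poly_sqr (R : realFieldType) (c A : R) :
  1/5 <= c -> c <= 1/2 -> 0 <= A -> A <= 16/25 -> 1 <= c * (43/9 - 2 * A) ->
  A * (16/9 - c * (7/9 + 2 * A)) ^+2 <= 4 * ((1 - c) * (1 - c + A * c) * (1 - A)).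
Proof.
move=> c0 c1 A0 A1 H.
have h1 : 0 <= (1/2 - c) * (16/25-A) by apply: mulr_ge0; lra.
have h2 : 0 <= (1/2 - c) * A by apply: mulr_ge0; lra.
have h3 : 0 <= (c-1/5) * (16/25-A) by apply: mulr_ge0; lra.
have h4 : 0 <= A * (16/25-A) by apply: mulr_ge0; lra.
have h5 : 0 <= (c * (43/9 - 2 * A) - 1) * (1/2-c) by apply: mulr_ge0; lra.
have h6 : 0 <= (c * (43/9 - 2 * A) - 1) * A by apply: mulr_ge0; lra.
nra.
Qed.

(** The sum of the second factor [G] and [y = (25/9) * (1 - 2 * c + r * c)] is free of [r], so
    [4 * (G * y) <= (G + y)^2] leaves an inequality in [c] and [A] only. *)
Lemma far_poly (R : realFieldType) (c r A : R) :
  0 <= c -> c <= 1/2 -> 0 <= r -> 0 <= A -> A <= 16/25 ->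
  0 <= c * (25/9) * (1 - r) - (1 - 2 * c) - 2 * A * c ->
  A * (25/9) * (c * (25/9) * (1 - r) - (1 - 2 * c) - 2 * A * c) * (1 - 2 * c + r * c)
   <= (1 - c) * (1 - c + A * c) * (1 - A).
Proof.
move=> c0 c1 r0 A0 A1 G0.
set G := (X in 0 <= X) in G0 *.
have cr : 0 <= c * r by exact: mulr_ge0.
have cA : 0 <= c * A by exact: mulr_ge0.
have H : 1 <= c * (43/9 - 2 * A) by rewrite /G in G0; lra.
have c5 : 1/5 <= c by lra.
have key := far_poly_sqr _ _ _ c5 c1 A0 A1 H.
pose y := (25/9) * (1 - 2 * c + r * c).
have xy : G + y = 16/9 - c * (7/9 + 2 * A) by rewrite /G /y; field.
have amgm : 4 * (G * y) <= (G + y) ^+ 2.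
  by have := sqr_ge0 (G - y); rewrite !expr2; lra.
have := ler_wpM2l A0 amgm; rewrite xy => h.
have -> : A * (25/9) * G * (1 - 2 * c + r * c) = A * (G * y) by rewrite /y; field.
lra.
Qed.

(* T (1 - T) / (S (1 + S - 2 T)) is the lower bound of logA - logB given by
   [logB_add_le], with S = 1 / (e - 1) + T; [gap_near] and [gap_far] compare it
   with what l1 misses, under the two ways in which l3 can fail to dominate. *)
Lemma gap_near (R : realFieldType) (c k rho z S : R) :
  let m := 1 - c in let a := z * (1 - rho) in let A := a * k in
  let T := m + A * c in
  0 < c -> c <= 1/2 -> 0 <= k -> k <= 2/3 -> 0 <= rho -> rho <= 1/2 ->
  0 <= z -> z <= 1 -> T < S -> S * (T - a * c) < c * T ->
  S * (1 + S - 2 * T) * (A * (z * (1 - 2 * c) / m + rho * k / (1 - rho * k)))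
    <= T * (1 - T).
Proof.
move=> m a A T c0 c1 k0 k1 r0 r1 z0 z1 TS SE.
have mE : m = 1 - c by [].
have aE : a = z * (1 - rho) by [].
have AE : A = a * k by [].
have TE : T = m + A * c by [].
clearbody T A a m.
have a0 : 0 <= a by rewrite aE; apply: mulr_ge0; lra.
have a1 : a <= 1 by rewrite aE; nra.
have ar : rho <= 1 - a by rewrite aE; nra.
have A0 : 0 <= A by rewrite AE mulr_ge0.
have A1 : A <= 2/3 by rewrite AE; nra.
have m0 : 1/2 <= m by rewrite mE; lra.
have mp : 0 < m by lra.
have Ac0 : 0 <= A * c by apply: mulr_ge0 => //; exact: ltW.
have cg := ltW c0.
have iA : 0 <= 1 - A by clear -A1; lra.
have T1 : 1 - T = c * (1 - A) by rewrite TE mE; ring.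
have rk : rho * k <= 1/3 by nra.
have rk0 : 0 <= rho * k by exact: mulr_ge0.
have rkp : 0 < 1 - rho * k by lra.
have [A00|An0] := eqVneq A 0.
  rewrite A00 mul0r mulr0 T1; apply: mulr_ge0; first by rewrite TE; lra.
  by apply: mulr_ge0; [exact: ltW|lra].
have Ap : 0 < A by rewrite lt_def An0.
have [eta etaE] : exists eta, eta = 1 - 2 * c by exists (1 - 2 * c).
(* With [E = X + Y], the bracket [Bk] satisfies [c * c * (A * Bk) <= X * Y], and
   [4 * (X * Y) <= E * E] closes the estimate. *)
have [E EE] : exists E, E = T - a * c by exists (T - a * c).
have [X XE] : exists X, X = c * A by exists (c * A).
have [Y YE] : exists Y, Y = eta + c * (1 - a) by exists (eta + c * (1 - a)).
rewrite -EE in SE; rewrite -etaE.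
have Xp : 0 < X by rewrite XE mulr_gt0.
have Y0 : 0 <= Y.
  by rewrite YE etaE addr_ge0 ?mulr_ge0 ?subr_ge0//; clear -c1; lra.
have EXY : E = X + Y by rewrite EE XE YE TE mE etaE; ring.
have Ep : 0 < E by clear -EXY Xp Y0; lra.
have Tp : 0 < T by clear -TE mp Ac0; lra.
have Eg := ltW Ep; have Tg := ltW Tp.
have Ec : E < c.
  have : T * E < c * T by apply: le_lt_trans SE; rewrite ler_wpM2r// ltW.
  by rewrite mulrC ltr_pM2r.
have c3 : 1/3 <= c.
  have : 0 <= c * (1 - a) by rewrite mulr_ge0 ?subr_ge0.
  by clear -Ec EXY YE etaE Xp; lra.
have cE : 0 <= c - E by rewrite subr_ge0 ltW.
have [Bk BkE] : exists Bk, Bk = z * eta / m + rho * k / (1 - rho * k).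
  by eexists.
rewrite -BkE.
have BkY : c * Bk <= Y.
  rewrite BkE mulrDr YE lerD//.
    rewrite mulrA ler_pdivrMr// mulrCA.
    have e0 : 0 <= eta by clear -etaE c1; lra.
    have : z * (c * eta) <= 1 * (c * eta).
      by rewrite ler_wpM2r// mulr_ge0// ltW.
    have : 0 <= (m - c) * eta by apply: mulr_ge0 => //; clear -mE c1; lra.
    by clear; lra.
  rewrite ler_wpM2l ?(ltW c0)// ler_pdivrMr//.
  have : 0 <= rho * (1 - rho * k - k) by apply: mulr_ge0 => //; clear -rk k1; lra.
  have : 0 <= (1 - a - rho) * (1 - rho * k) by rewrite mulr_ge0 ?(ltW rkp)// subr_ge0.
  by clear; lra.
have Bk0 : 0 <= Bk.
  rewrite BkE; apply: addr_ge0; apply: divr_ge0; rewrite ?(ltW mp) ?(ltW rkp)//.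
  by rewrite mulr_ge0// etaE; clear -c1; lra.
have q1 : 0 <= E * (1 - T) + T * (c - E).
  by rewrite T1 addr_ge0// !mulr_ge0.
(* The bound [S * E < c * T] enters twice, once for each factor that contains [S]. *)
have s1 : S * (1 + S - 2 * T) * (E * E) <= c * T * (E * (1 - T) + T * (c - E)).
  have -> : S * (1 + S - 2 * T) * (E * E) = (S * E) * (E * (1 - 2 * T) + S * E) by ring.
  have -> : E * (1 - T) + T * (c - E) = E * (1 - 2 * T) + c * T by ring.
  apply: ler_pM; [| |exact: ltW|by rewrite lerD2l ltW].
    by rewrite mulr_ge0// (le_trans Tg)// ltW.
  have -> : E * (1 - 2 * T) + S * E = E * ((1 - T) + (S - T)) by ring.
  apply: mulr_ge0 => //; rewrite T1; apply: addr_ge0; first exact: mulr_ge0.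
  by rewrite subr_ge0 ltW.
have s2 : X * Y * (E * (1 - T) + T * (c - E)) <= c * c * (1 - A) * (E * E).
  have h1 : E * (1 - T) + T * (c - E) <= c * T - X * (2 * T - 1).
    have : 0 <= Y * (2 * T - 1) by apply: mulr_ge0 => //; clear -TE m0 Ac0; lra.
    by rewrite EXY; clear; lra.
  have h2 : c * T - X * (2 * T - 1) <= 4 * (c * c * (1 - A)).
    have : 0 <= c * ((1 - A) * (c * (5 - 2 * A) - 1)).
      apply: mulr_ge0; first exact: ltW.
      by rewrite mulr_ge0//; clear -c3 A1 Ac0; nra.
    by rewrite XE TE mE; clear; lra.
  have h3 : 4 * (X * Y) <= E * E.
    by rewrite EXY; have := sqr_ge0 (X - Y); rewrite !expr2; clear; lra.
  have XY0 : 0 <= X * Y by apply: mulr_ge0 => //; exact: ltW.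
  have h4 := ler_wpM2l XY0 (le_trans h1 h2).
  have h5 : 0 <= c * c * (1 - A) by rewrite !mulr_ge0.
  have h6 := ler_wpM2l h5 h3.
  by clear -h4 h6; lra.
have E2 : 0 < E * E by exact: mulr_gt0.
have cc : 0 < c * c by exact: mulr_gt0.
rewrite -(ler_pM2l E2) -(ler_pM2l cc).
have [Q QE] : exists Q, Q = E * (1 - T) + T * (c - E) by eexists.
rewrite -QE in q1 s1 s2.
have ABk : c * c * (A * Bk) <= X * Y.
  have -> : c * c * (A * Bk) = X * (c * Bk) by rewrite XE; ring.
  by rewrite ler_wpM2l// ltW.
have ABk0 : 0 <= c * c * (A * Bk) by apply: mulr_ge0; [exact: ltW|exact: mulr_ge0].
have t1 := ler_wpM2r ABk0 s1.
have cTQ : 0 <= c * T * Q by rewrite !mulr_ge0.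
have t2 := ler_wpM2l cTQ ABk.
have cT0 : 0 <= c * T by rewrite mulr_ge0.
have t3 := ler_wpM2l cT0 s2.
by rewrite T1; clear -t1 t2 t3; lra.
Qed.

(** From [1 - k >= 9/25] follows [S <= c * (25/9) * (1 - rho * k)]. The factor [1 - rho * k] cancels
    the denominator in the bracket, and [far_poly] remains. *)
Lemma gap_far (R : realFieldType) (c k rho z S : R) :
  let m := 1 - c in let a := z * (1 - rho) in let A := a * k in
  let T := m + A * c in
  0 < c -> c <= 1/2 -> 0 <= k -> k <= 16/25 -> 0 <= rho -> rho <= 1/2 ->
  0 <= z -> z <= 1 -> T < S -> S * (1 - k) <= c * (1 - rho * k) ->
  S * (1 + S - 2 * T) * (A * (z * (1 - 2 * c) / m + rho * k / (1 - rho * k)))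
    <= T * (1 - T).
Proof.
move=> m a A T c0 c1 k0 k1 r0 r1 z0 z1 TS Sk.
have a0 : 0 <= a by apply: mulr_ge0; lra.
have a1 : a <= 1 by rewrite /a; nra.
have A0 : 0 <= A by exact: mulr_ge0.
have A1 : A <= 16/25 by rewrite /A; nra.
have m0 : 1/2 <= m by rewrite /m; lra.
have mp : 0 < m by lra.
have T1 : 1 - T = c * (1 - A) by rewrite /T /m; ring.
have eta0 : 0 <= 1 - 2 * c by lra.
have T0 : 0 < T by rewrite /T; have : 0 <= A * c by [apply: mulr_ge0 => //; exact: ltW]; lra.
pose r := rho * k.
have r0' : 0 <= r by exact: mulr_ge0.
have r1' : r < 1 by rewrite /r; nra.
clearbody a A.
have S1 : S <= c * (25/9) * (1 - r).
  have : S * (9/25) <= S * (1 - k) by rewrite ler_wpM2l//; lra.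
  rewrite -/r in Sk; lra.
pose G := c * (25/9) * (1 - r) - (1 - 2 * c) - 2 * A * c.
have G1 : 1 + S - 2 * T <= G by rewrite /G /T /m; lra.
have G0 : 0 <= 1 + S - 2 * T.
  have : 0 <= c * (1 - A) by apply: mulr_ge0; lra.
  by lra.
have poly := far_poly _ _ _ _ (ltW c0) c1 r0' A0 A1 (le_trans G0 G1).
rewrite -/G -/m in poly.
set Bk := _ + _ / _.
have Bk0 : 0 <= Bk.
  rewrite /Bk -/r.
  by apply: addr_ge0; apply: divr_ge0; rewrite ?(ltW mp) ?mulr_ge0// subr_ge0 ltW.
have BkE : (1 - r) * Bk <= (1 - 2 * c + r * c) / m.
  rewrite /Bk -/r mulrDr [_ * (r / _)]mulrC divfK; last by rewrite gt_eqF// subr_gt0.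
  rewrite ler_pdivlMr// mulrDl mulrA divfK ?gt_eqF//.
  have : 0 <= (1 - z) * ((1 - r) * (1 - 2 * c)).
    by rewrite !mulr_ge0// subr_ge0// ltW.
  by rewrite /m; clear; lra.
have h1 : S * (1 + S - 2 * T) <= c * (25/9) * (1 - r) * G.
  by apply: ler_pM => //; lra.
have h2 : S * (1 + S - 2 * T) * (A * Bk) <= c * (25/9) * (1 - r) * G * (A * Bk).
  by rewrite ler_wpM2r// mulr_ge0.
apply: (le_trans h2); rewrite T1.
have GA : 0 <= c * (A * (25/9) * G).
  apply: mulr_ge0; first exact: ltW.
  by rewrite !mulr_ge0//; exact: le_trans G1.
have h3 := ler_wpM2l GA BkE.
have h4 : c * (A * (25/9) * G) * ((1 - 2 * c + r * c) / m) <= c * (T * (1 - A)).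
  rewrite -mulrA ler_wpM2l ?(ltW c0)// mulrA ler_pdivrMr//.
  by rewrite -/T in poly; lra.
lra.
Qed.

(** * Lower bounds for the gain of l2 at p = 0 *)

(* With k = (M - m) / (1 - m): a lower bound of l2 at p = 0 minus logA at m. *)
Definition qgain {R : realFieldType} (k : R) : R :=
  k / (2 * (1 - k)) - k * (4 - k) / (4 * (2 - k)).

(** Clearing the denominator leaves a polynomial inequality in [k]. The bounds that follow start at
    the thresholds of the case distinctions in [logB_bound] and [logB_bound_ge]. *)
Lemma qgain_ge (R : realFieldType) (k v : R) : k < 1 ->
  4 * v * (1 - k) * (2 - k) <= 2 * k * (2 - k) - k * (4 - k) * (1 - k) ->
  v <= qgain k.
Proof.
move=> k1 h.
have -> : qgain k = (2 * k * (2 - k) - k * (4 - k) * (1 - k)) / (4 * (1 - k) * (2 - k)).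
  by rewrite /qgain; field; rewrite !subr_eq0; apply/andP; split; rewrite gt_eqF//; lra.
have p1 : 0 < 4 * (1 - k) by lra.
have p2 : 0 < 2 - k by lra.
by rewrite ler_pdivlMr ?mulr_gt0//; lra.
Qed.

Lemma qgain_ge1 (R : realFieldType) (k : R) : 3/4 <= k -> k < 1 -> 1 <= qgain k.
Proof.
move=> k0 k1; apply: qgain_ge => //.
have : 0 <= (k - 3/4) * (1 - k) by apply: mulr_ge0; lra.
have : 0 <= k * ((k - 3/4) * (1 - k)) by apply: mulr_ge0; [lra|apply: mulr_ge0; lra].
lra.
Qed.

Lemma qgain_ge_id (R : realFieldType) (k : R) : 7/10 <= k -> k <= 3/4 -> k <= qgain k.
Proof.
move=> k0 k1; apply: qgain_ge; first lra.
have : 0 <= k * ((k - 7/10) * (3/4 - k)) by apply: mulr_ge0; [lra|apply: mulr_ge0; lra].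
have : 0 <= k * (k - 7/10) by apply: mulr_ge0; lra.
lra.
Qed.

Lemma qgain_ge34 (R : realFieldType) (k : R) : 16/25 <= k -> k <= 3/4 -> k * (3/4) <= qgain k.
Proof.
move=> k0 k1; apply: qgain_ge; first lra.
have : 0 <= k * ((k - 16/25) * (3/4 - k)) by apply: mulr_ge0; [lra|apply: mulr_ge0; lra].
have : 0 <= k * (k - 16/25) by apply: mulr_ge0; lra.
lra.
Qed.

Lemma qgain_ge_third (R : realFieldType) (k : R) : 2/3 <= k -> k <= 3/4 -> k - 1/10 <= qgain k.
Proof.
move=> k0 k1; apply: qgain_ge; first lra.
have : 0 <= k * ((k - 2/3) * (3/4 - k)) by apply: mulr_ge0; [lra|apply: mulr_ge0; lra].
have : 0 <= (k - 2/3) * (k - 2/3) by apply: mulr_ge0; lra.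
lra.
Qed.

(** Here [x] stands for [(e - 1)^-1]. The conclusion is the premise of [logB_add_qgain_le] for
    [X = k], on a range where [qgain k] may fall short of [k]. *)
Lemma qgain_far (R : realFieldType) (c k x : R) :
  0 < c -> c <= 1/2 -> 16/25 <= k -> k <= 7/10 -> 0 <= x ->
  (x + 1 - c) * (1 - k) <= c * (1 - k / 2 * (1 - k)) ->
  (k - qgain k) * (x * (1 + x) + (1 - c) * c) <= (1 - c) * c.
Proof.
move=> c0 c1 k0 k1 x0 h.
(* On a subinterval ending at [K], [f] bounds [k - qgain k] and [B * c] bounds [x]. Then [c <= 1/2]
   eliminates [c] and leaves an inequality between the numbers [f] and [B]. *)
have piece (f K B : R) : k <= K -> k - qgain k <= f -> 0 <= f -> K <= 7/10 ->
    (1 - K / 2 * (1 - K)) <= (B + 1) * (1 - K) -> f * (B * (2 + B)) <= 1 - f ->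
    (k - qgain k) * (x * (1 + x) + (1 - c) * c) <= (1 - c) * c.
  move=> kK kf f0 K7 KB fB.
  have B1 : 0 <= B by nra.
  have xB : x <= B * c.
    have h1 : (x + 1 - c) * (1 - k) <= c * ((B + 1) * (1 - k)).
      apply: (le_trans h); rewrite ler_wpM2l//; first exact: ltW.
      nra.
    have : x + 1 - c <= c * (B + 1).
      by rewrite -(ler_pM2r (_ : 0 < 1 - k)); [rewrite -mulrA|lra].
    lra.
  have xx : x * (1 + x) <= B * c * (1 + B / 2).
    apply: ler_pM => //; [lra|].
    have : 0 <= B * (1/2 - c) by apply: mulr_ge0; lra.
    lra.
  have mc : c / 2 <= (1 - c) * c by nra.
  have q0 : 0 <= x * (1 + x) + (1 - c) * c.
    by apply: addr_ge0; apply: mulr_ge0; lra.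
  apply: le_trans (ler_wpM2r q0 kf) _.
  have : f * (x * (1 + x)) <= f * (B * c * (1 + B / 2)) by rewrite ler_wpM2l.
  have : c * (f * (B * (2 + B))) <= c * (1 - f) by rewrite ler_wpM2l// ltW.
  have : (1 - f) * (c / 2) <= (1 - f) * ((1 - c) * c).
    by rewrite ler_wpM2l//; nra.
  lra.
have hints (lo hi : R) : lo <= k -> k <= hi ->
    0 <= k * ((k - lo) * (hi - k)) /\ 0 <= (k - lo) * (k - lo).
  by move=> *; split; apply: mulr_ge0; try lra; apply: mulr_ge0; lra.
have qv (v : R) : 4 * (k - v) * (1 - k) * (2 - k) <= 2 * k * (2 - k) - k * (4 - k) * (1 - k) ->
    k - qgain k <= v.
  by move=> hv; have := @qgain_ge _ k (k - v) _ hv; lra.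
have [k65|k65] := leP k (13/20).
  apply: (piece (3/20) (13/20) (23/15) k65); [|lra|lra|lra|lra].
  by apply: qv; have [] := hints (16/25) (13/20) k0 k65; lra.
have [k68|k68] := leP k (17/25).
  apply: (piece (1/8) (17/25) (9/5) k68); [|lra|lra|lra|lra].
  by apply: qv; have [] := hints (13/20) (17/25) (ltW k65) k68; lra.
apply: (piece (1/20) (7/10) 2 k1); [|lra|lra|lra|lra].
by apply: qv; have [] := hints (17/25) (7/10) (ltW k68) k1; lra.
Qed.

(** * Slope of [logB] and its gap to [logA] *)

Lemma logB_homo (R : realType) (e T T' : R) :
  1 <= e -> 0 <= T -> T <= T' -> logB e T' <= logB e T.
Proof.
move=> e1 T0 TT'; have e0 : 0 < e by lra.
have b0 : 0 < e^-1 by rewrite invr_gt0.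
have b1 : e^-1 <= 1 by rewrite invf_le1.
have q : 0 <= (1 - e^-1) * T by apply: mulr_ge0 => //; lra.
have q' : (1 - e^-1) * T <= (1 - e^-1) * T' by rewrite ler_wpM2l//; lra.
by rewrite /logB lerN2 ler_ln ?posrE; lra.
Qed.

(** The argument of the logarithm is proportional to [(e - 1)^-1 + T], so this is the tangent bound
    at [T]. *)
Lemma logB_sub_le (R : realType) (e T T' : R) :
  1 < e -> 0 <= T -> T <= T' ->
  logB e T - logB e T' <= (T' - T) / ((e - 1)^-1 + T).
Proof.
move=> e1 T0 TT'; have e0 : 0 < e by lra.
have b0 : 0 < e^-1 by rewrite invr_gt0.
have b1 : e^-1 < 1 by rewrite invf_lt1.
have q : 0 <= (1 - e^-1) * T by apply: mulr_ge0 => //; lra.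
have q' : (1 - e^-1) * T <= (1 - e^-1) * T' by rewrite ler_wpM2l//; lra.
have := ln_sub_le _ (e^-1 + (1 - e^-1) * T') (e^-1 + (1 - e^-1) * T).
have -> : (e^-1 + (1 - e^-1) * T' - (e^-1 + (1 - e^-1) * T)) / (e^-1 + (1 - e^-1) * T)
    = (T' - T) / ((e - 1)^-1 + T).
  have : 0 < 1 + (e - 1) * T.
    by have : 0 <= (e - 1) * T by [apply: mulr_ge0; lra]; lra.
  move=> h; field; rewrite !gt_eqF//; lra.
rewrite /logB => h; have := h; lra.
Qed.

(** With [b = (e - 1)^-1] the gap is [ln Z] for [Z = (1 + b - T) * (b + T) / (b * (1 + b))], and
    [ln Z >= 1 - Z^-1], which is the stated fraction. *)
Lemma logB_add_le (R : realType) (e T : R) :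
  1 < e -> 0 <= T -> T <= 1 ->
  let S := (e - 1)^-1 + T in
  logB e T + T * (1 - T) / (S * (1 + S - 2 * T)) <= logA e T.
Proof.
move=> e1 T0 T1; pose b := (e - 1)^-1.
have b0 : 0 < b by rewrite invr_gt0; lra.
have eE : e = 1 + b^-1 by rewrite /b invrK; ring.
rewrite /= -/b eE; clearbody b; clear e e1 eE.
have h1 : 0 < 1 + b - T by lra.
have h2 : 0 < b + T by lra.
have h3 : 0 < 1 + b by lra.
rewrite /logA /logB.
have -> : 1 + b^-1 - (1 + b^-1 - 1) * T = (1 + b - T) / b by field; rewrite gt_eqF.
have -> : (1 + b^-1)^-1 + (1 - (1 + b^-1)^-1) * T = (b + T) / (1 + b).
  by field; rewrite !gt_eqF//.
have := ln_sub_le _ 1 ((1 + b - T) / b * ((b + T) / (1 + b))) ltr01.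
rewrite ln1 lnM ?posrE ?divr_gt0// => /(_ _)/wrap[]; first by rewrite mulr_gt0// divr_gt0.
have -> : (1 - (1 + b - T) / b * ((b + T) / (1 + b))) / ((1 + b - T) / b * ((b + T) / (1 + b)))
  = - (T * (1 - T) / ((b + T) * (1 + (b + T) - 2 * T))).
  by field; rewrite ?gt_eqF//; do ?[apply/andP; split]; rewrite ?gt_eqF//; lra.
lra.
Qed.

Lemma logB_le_logA (R : realType) (e T : R) :
  1 <= e -> 0 <= T -> T <= 1 -> logB e T <= logA e T.
Proof.
rewrite le_eqVlt => /predU1P[<-|e1] T0 T1.
  by rewrite /logA /logB invr1 subrr !mul0r subr0 addr0 ln1 oppr0.
apply: le_trans (logB_add_le _ _ _ e1 T0 T1); rewrite /= lerDl.
have b0 : 0 < (e - 1)^-1 by rewrite invr_gt0; lra.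
by apply: divr_ge0; apply: mulr_ge0; lra.
Qed.

(** For [c = 1 - m] and [k * c = M - m] the right side is l2 at [p = 0]. The argument of the
    logarithm shrinks at most by the factor [r = 1 - k / 2], and [ln r^-1 <= (r^-1 - r) / 2]. *)
Lemma logA_mid_ge (R : realType) (e c k : R) :
  1 <= e -> 0 < c -> 0 <= k -> k < 1 ->
  logA e (1 - c) + qgain k <= logA e (1 - c + k * c / 2) + k * c / 2 / (c - k * c).
Proof.
move=> e1 c0 k0 k1.
have -> : k * c / 2 / (c - k * c) = k / (2 * (1 - k)).
  by field; rewrite (_ : c - k * c = c * (1 - k)) ?mulf_neq0 ?subr_eq0 ?gt_eqF//; ring.
suff : logA e (1 - c) - logA e (1 - c + k * c / 2) <= k * (4 - k) / (4 * (2 - k)).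
  by rewrite /qgain; lra.
have kc : 0 <= k * c by apply: mulr_ge0 => //; exact: ltW.
have kc1 : k * c <= c by have : 0 <= (1 - k) * c by [apply: mulr_ge0; lra]; lra.
pose r := 1 - k / 2; have r0 : 0 < r by rewrite /r; lra.
have h0 : 0 <= (e - 1) * c by apply: mulr_ge0; lra.
have h1 : 0 <= (e - 1) * (c - k * c / 2) by apply: mulr_ge0; lra.
have p1 : 0 < e - (e - 1) * (1 - c) by lra.
have p2 : 0 < e - (e - 1) * (1 - c + k * c / 2) by lra.
have le1 : r * (e - (e - 1) * (1 - c)) <= e - (e - 1) * (1 - c + k * c / 2).
  by rewrite /r; lra.
have : ln (r * (e - (e - 1) * (1 - c))) <= ln (e - (e - 1) * (1 - c + k * c / 2)).
  by rewrite ler_ln ?posrE// mulr_gt0.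
rewrite lnM ?posrE// /logA => hln.
have := @ln_le_half_sub_inv _ r^-1.
rewrite invf_ge1// invrK lnV ?posrE// => /(_ _)/wrap[]; first by rewrite /r; lra.
have -> : (r^-1 - r) / 2 = k * (4 - k) / (4 * (2 - k)).
  by rewrite /r; field; rewrite !gt_eqF//; lra.
lra.
Qed.

(** * Removing a record when m >= 1/2 *)

(* c = 1 - m, k = (M - m) / (1 - m), rho = 1 - lam, and z is the mean distance
   to the removed record in the metric d; T is its score s'. *)
Lemma kept_cost_le (R : realFieldType) (c k rho z : R) :
  let m := 1 - c in let a := z * (1 - rho) in let A := a * k in let T := m + A * c in
  0 < c -> c <= 1/2 -> 0 <= k -> k <= 3/4 -> 0 <= rho -> rho <= 1/2 -> 0 <= z -> z <= 1 ->
  [/\ (1 - z) * (A * c / T) + z * ((1 - rho) * k / (1 - rho * k)) <= k,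
      (1 - z) * (A * c / T) + z * ((1 - rho) * k / (1 - rho * k)) <= k * (z * (2 - z)) &
      (1 - z) * (A * c / T) + z * ((1 - rho) * k / (1 - rho * k))
        <= A * c / m + (1 - a) * (A * c / (c - A * c))
           + A * (z * (1 - 2 * c) / m + rho * k / (1 - rho * k))].
Proof.
move=> m a A T c0 c1 k0 k1 r0 r1 z0 z1.
have az : a <= z.
  by have : 0 <= z * rho by [exact: mulr_ge0]; rewrite /a; lra.
have a0 : 0 <= a by apply: mulr_ge0; lra.
have aE : z * (1 - rho) = a by [].
have AE : a * k = A by [].
have A0 : 0 <= A by exact: mulr_ge0.
have Ak : A <= k * z.
  by have : 0 <= (z - a) * k by [apply: mulr_ge0; lra]; lra.
have A1 : A <= 3/4.
  by have : 0 <= (1 - z) * k by [apply: mulr_ge0; lra]; lra.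
have Ac0 : 0 <= A * c by apply: mulr_ge0 => //; exact: ltW.
have m0 : 1/2 <= m by rewrite /m; lra.
have mT : m <= T by rewrite /T; lra.
have rk0 : 0 <= rho * k by exact: mulr_ge0.
have rk1 : 0 <= (1/2 - rho) * k by apply: mulr_ge0; lra.
have cm : 1 - c = m by [].
clearbody T A a m.
have r1' : 0 < 1 - rho * k by lra.
have mp : 0 < m by lra.
have om : (1 - rho) * k / (1 - rho * k) <= k.
  rewrite ler_pdivrMr//; have : 0 <= rho * k * (1 - k) by apply: mulr_ge0; lra.
  lra.
have gm : A * c / T <= A * c / m by rewrite ler_wpM2l// lef_pV2 ?posrE//; lra.
have gA : A * c / m <= A.
  by rewrite ler_pdivrMr// ler_wpM2l//; lra.
have h1 : (1 - z) * (A * c / T) <= (1 - z) * (k * z).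
  by rewrite ler_wpM2l ?subr_ge0// (le_trans gm)// (le_trans gA).
have h2 : z * ((1 - rho) * k / (1 - rho * k)) <= z * k by rewrite ler_wpM2l.
have h3 : 0 <= k * ((1 - z) * (1 - z)).
  by rewrite !mulr_ge0 ?subr_ge0.
split; [clear -h1 h2 h3; lra|clear -h1 h2; lra|].
have h4 : (1 - z) * (A * c / T) <= (1 - z) * (A * c / m) by rewrite ler_wpM2l//; lra.
have -> : z * ((1 - rho) * k / (1 - rho * k)) = A + A * (rho * k / (1 - rho * k)).
  by rewrite -AE -aE; field; rewrite gt_eqF.
have h5 : (1 - a) * A <= (1 - a) * (A * c / (c - A * c)).
  rewrite ler_wpM2l//; first lra.
  rewrite ler_pdivlMr; last first.
    have : 0 <= (3/4 - A) * c by rewrite mulr_ge0 ?subr_ge0// ltW.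
    by clear -c0; lra.
  have : 0 <= A * (A * c) by exact: mulr_ge0.
  by clear; lra.
have -> : A * (z * (1 - 2 * c) / m + rho * k / (1 - rho * k))
   = z * (A - A * c / m) + A * (rho * k / (1 - rho * k)).
  by rewrite -cm; field; rewrite cm !gt_eqF.
have : 0 <= A * (z - a) by rewrite mulr_ge0 ?subr_ge0.
by clear -h4 h5; lra.
Qed.

(** The worst case is [rho = 0], [z = 1/2]; it yields the premise of [qgain_far]. *)
Lemma far_beta (R : realFieldType) (c k rho z beta : R) :
  0 <= c -> 0 <= k -> k <= 1 -> 0 <= rho -> z <= 1 -> 1/2 <= z ->
  (beta + (1 - c + z * (1 - rho) * k * c)) * (1 - k) <= c * (1 - rho * k) ->
  (beta + 1 - c) * (1 - k) <= c * (1 - k / 2 * (1 - k)).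
Proof.
move=> c0 k0 k1 r0 z1 z12 hS.
have h1 : 0 <= c * (k * (rho * (1 - z * (1 - k)))).
  do 3!apply: mulr_ge0 => //.
  by have : 0 <= (1 - z) * (1 - k) by [apply: mulr_ge0; lra]; lra.
have h2 : 0 <= c * (k * ((z - 1/2) * (1 - k))).
  by do 3!apply: mulr_ge0 => //; lra.
lra.
Qed.

(** With [E = T - a * c >= k * c] and [k >= 2/3], the last hypothesis forces [beta <= 1/2] and
    [c >= 1/3]. *)
Lemma near_beta (R : realFieldType) (c k a beta : R) :
  0 < c -> c <= 1/2 -> 2/3 <= k -> k <= 1 -> 0 <= a -> a <= 1 -> 0 < beta ->
  (beta + (1 - c + a * k * c)) * (1 - c + a * k * c - a * c)
    <= c * (1 - c + a * k * c) ->
  1/10 * (beta * (1 + beta) + (1 - c) * c) <= (1 - c) * c.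
Proof.
move=> c0 c1 k0 k1 a0 a1 b0 hnear.
have ca : 0 <= c * (1 - a) by apply: mulr_ge0; lra.
have cak : 0 <= c * (1 - a) * (1 - k) by apply: mulr_ge0; lra.
have kc23 : 2/3 * c <= k * c by rewrite ler_wpM2r ?(ltW c0)//; lra.
have akc : 0 <= a * k * c by rewrite !mulr_ge0//; lra.
have akc1 : a * k * c <= c.
  by rewrite ger_pMl// mulr_ile1//; lra.
have [T TE] : exists T, T = 1 - c + a * k * c by exists (1 - c + a * k * c).
have [E EE] : exists E, E = T - a * c by exists (T - a * c).
have Ek : k * c <= E by rewrite EE TE; lra.
have EE' : E = 1 - 2 * c + c * (1 - a) + a * k * c by rewrite EE TE; ring.
have Tp : 0 < T by lra.
have T1 : T <= 1 by lra.
have hE : beta * E <= T * (c - E) by rewrite -TE -EE in hnear; lra.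
clear hnear EE.
have Ec : 0 <= c - E.
  by rewrite -(pmulr_rge0 _ Tp); apply: le_trans hE; apply: mulr_ge0; lra.
have b12 : beta <= 1/2.
  have h3 : beta * (2/3 * c) <= beta * E by rewrite ler_wpM2l//; lra.
  have h4 : T * (c - E) <= 1 * (c - E) by rewrite ler_wpM2r.
  by rewrite -(ler_pM2r c0); lra.
have c3 : 1/3 <= c by lra.
have : 0 <= (c - 1/3) * (1/2 - c) by apply: mulr_ge0; lra.
have : 0 <= (1/2 - beta) * (3/2 + beta) by apply: mulr_ge0; lra.
lra.
Qed.

(** The left side is the bound of [logB_sub_le] for raising [T] to [M], the right side the slack
    between [k] and the cost of the kept records. The last two hypotheses compare the coefficients
    of [1 - z] and of [z]. *)
Lemma slope_le_slack (R : realFieldType) (c k rho z S : R) :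
  let a := z * (1 - rho) in let T := 1 - c + a * k * c in
  0 <= k -> 0 < T -> 0 < S -> 0 <= rho -> 0 <= z -> z <= 1 -> 0 < 1 - rho * k ->
  c * T <= S * (T - a * c) -> c * (1 - rho * k) <= S * (1 - k) ->
  k * ((1 - z) * c + z * (rho * c)) / S
    <= k - ((1 - z) * (a * k * c / T) + z * ((1 - rho) * k / (1 - rho * k))).
Proof.
move=> a T; have aE : a = z * (1 - rho) by [].
clearbody T a => k0 Tp S0 r0 z0 z1 rkp h1 h2.
have -> : k - ((1 - z) * (a * k * c / T) + z * ((1 - rho) * k / (1 - rho * k)))
    = k * ((1 - z) * ((T - a * c) / T) + z * (rho * ((1 - k) / (1 - rho * k)))).
  by field; rewrite !gt_eqF.
rewrite -mulrA ler_wpM2l// mulrDl -!mulrA lerD// ler_wpM2l//; first lra.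
  by rewrite ler_pdivrMr// mulrAC ler_pdivlMr// [_ * S]mulrC.
rewrite ler_wpM2l//.
by rewrite ler_pdivrMr// mulrAC ler_pdivlMr// [_ * S]mulrC.
Qed.

(** The gap between [logB] and [logA] at [m = 1 - c] covers the excess of [X] over [qgain k]. *)
Lemma logB_add_qgain_le (R : realType) (c k e V X : R) :
  0 < c -> c <= 1/2 -> 1 < e -> logA e (1 - c) + qgain k <= V ->
  let beta := (e - 1)^-1 in
  (X - qgain k) * (beta * (1 + beta) + (1 - c) * c) <= (1 - c) * c ->
  logB e (1 - c) + X <= V.
Proof.
move=> c0 c1 e1 H2 beta hX.
have b0 : 0 < beta by rewrite invr_gt0; lra.
have mT1 : 1 - c <= 1 by lra.
have m00 : 0 <= 1 - c by lra.
have := logB_add_le _ e (1 - c) e1 m00 mT1.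
rewrite /= -/beta.
have -> : (beta + (1 - c)) * (1 + (beta + (1 - c)) - 2 * (1 - c))
    = beta * (1 + beta) + (1 - c) * c.
  by ring.
have -> : (1 - c) * (1 - (1 - c)) = (1 - c) * c by ring.
have q0 : 0 < beta * (1 + beta) + (1 - c) * c.
  by apply: addr_gt0; apply: mulr_gt0; lra.
rewrite -ler_pdivlMr// in hX; lra.
Qed.

Lemma logB_bound_ge (R : realType) (c k rho z e V : R) :
  let m := 1 - c in let a := z * (1 - rho) in let A := a * k in let T := m + A * c in
  0 < c -> c <= 1/2 -> 0 <= k -> k <= 3/4 -> 0 <= rho -> rho <= 1/2 ->
  0 <= z -> z <= 1 -> 1 <= e ->
  logA e T + A * c / m + (1 - a) * (A * c / (c - A * c)) <= V ->
  logA e m + qgain k <= V ->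
  logB e (m + k * c) + k <= V ->
  logB e T + (1 - z) * (A * c / T) + z * ((1 - rho) * k / (1 - rho * k)) <= V.
Proof.
move=> m a A T c0 c1 k0 k1 r0 r1 z0 z1 e1 H1 H2 H3.
have [rk rz r3] := kept_cost_le _ _ _ _ _ c0 c1 k0 k1 r0 r1 z0 z1.
rewrite -/m -/a -/A -/T in rk rz r3.
rewrite -addrA; set rest := _ + z * _ in rk rz r3 *.
have az : a <= z.
  by have : 0 <= z * rho by [exact: mulr_ge0]; rewrite /a; lra.
have a0 : 0 <= a by apply: mulr_ge0; lra.
have a1 : a <= 1 by lra.
have A0 : 0 <= A by exact: mulr_ge0.
have Ak : A <= k.
  by have : 0 <= (1 - a) * k by [apply: mulr_ge0; lra]; rewrite /A; lra.
have Ac0 : 0 <= A * c by apply: mulr_ge0 => //; exact: ltW.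
have Ac1 : A * c <= k * c by rewrite ler_wpM2r// ltW.
have m0 : 1/2 <= m by rewrite /m; lra.
have mT : m <= T by rewrite /T; lra.
have kc1 : k * c <= c by rewrite ler_piMl ?(ltW c0)//; clear -k1; lra.
have T1 : T <= 1 by rewrite /T /m; lra.
have Tp : 0 < T by lra.
(* For [e = 1] the inverse of [e - 1] has the default value 0; both logarithms vanish, and l3
   suffices. *)
move: e1; rewrite le_eqVlt => /predU1P[e1|e1].
  apply: le_trans H3; rewrite -e1 /logB invr1 subrr !mul0r addr0 ln1 oppr0 !add0r.
  exact: rk.
pose beta := (e - 1)^-1.
have b0 : 0 < beta by rewrite invr_gt0; lra.
pose S := beta + T.
have S0 : 0 < S by rewrite /S; lra.
have m00 : 0 <= m by clear -m0; lra.
have m1 : m <= 1 by clear -T1 mT; lra.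
have e1' := ltW e1.
have hBm : logB e T <= logB e m by apply: logB_homo.
have hAB : logB e m <= logA e m by apply: logB_le_logA.
(* For [z <= 1/2] the cost is at most [3/4 * k], and for [k > 7/10] at most [k]; both are below
   [qgain k]. Only the remaining range needs a lower bound on [e]. *)
have far : S * (1 - k) <= c * (1 - rho * k) -> 16/25 <= k -> logB e T + rest <= V.
  move=> hS k64.
  have [z12|z12] := leP z (1/2).
    have hq := qgain_ge34 _ _ k64 k1.
    have : k * (z * (2 - z)) <= k * (3/4).
      rewrite ler_wpM2l//.
      have : 0 <= (1/2 - z) * (3/2 - z) by rewrite mulr_ge0 ?subr_ge0//; clear -z12; lra.
      by clear; lra.
    by move: rz H2 hBm hAB hq; clear; lra.
  have [k7|k7] := leP k (7/10); last first.
    have hq := qgain_ge_id _ _ (ltW k7) k1.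
    by move: rk H2 hBm hAB hq; clear; lra.
  have k1' : k <= 1 by clear -k1; lra.
  have hb := far_beta _ _ _ _ _ _ (ltW c0) k0 k1' r0 z1 (ltW z12) hS.
  have hX := qgain_far _ _ _ _ c0 c1 k64 k7 (ltW b0) hb.
  have := logB_add_qgain_le _ _ _ _ _ _ c0 c1 e1 H2 hX.
  by rewrite -/m; move: rk hBm; clear; lra.
have C2 : S * (1 + S - 2 * T) * (A * (z * (1 - 2 * c) / m + rho * k / (1 - rho * k)))
    <= T * (1 - T) -> logB e T + rest <= V.
  move=> hC; have := logB_add_le _ e T e1 (ltW Tp) T1.
  rewrite /= -/beta -/S; set F := _ / _ => hF.
  have : A * (z * (1 - 2 * c) / m + rho * k / (1 - rho * k)) <= F.
    rewrite /F ler_pdivlMr; first by rewrite mulrC.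
    by rewrite mulr_gt0//; clear -T1 b0; rewrite /S; lra.
  by move: r3 H1 hF; clear; lra.
(* The two case distinctions test the hypotheses of [slope_le_slack]; the opposite inequalities
   limit [S], and thus keep [e] away from 1. *)
have [hnear|hnear] := ltP (S * (T - a * c)) (c * T).
  have [k23|k23] := leP k (2/3).
    by apply: C2; apply: gap_near => //; rewrite -/m -/a -/A -/T /S ltrDr.
  have k1' : k <= 1 by lra.
  have hn := near_beta _ _ _ _ _ c0 c1 (ltW k23) k1' a0 a1 b0 (ltW hnear).
  have hX : (k - qgain k) * (beta * (1 + beta) + (1 - c) * c) <= (1 - c) * c.
    apply: le_trans hn; rewrite ler_wpM2r//.
      by apply: addr_ge0; apply: mulr_ge0; move: b0 c0 c1; clear; lra.
    by have := qgain_ge_third _ _ (ltW k23) k1; clear; lra.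
  have := logB_add_qgain_le _ _ _ _ _ _ c0 c1 e1 H2 hX.
  by rewrite -/m; move: rk hBm; clear; lra.
have [hfar|hfar] := leP (S * (1 - k)) (c * (1 - rho * k)).
  have [k64|k64] := leP (16/25) k; first exact: far.
  by apply: C2; apply: gap_far => //; rewrite -?/m -?/a -?/A -?/T ?/S ?ltrDr// ltW.
(* Now [T] may be raised to [M], which leads to l3. *)
apply: le_trans H3.
have TM : T <= m + k * c by rewrite /T lerD2l.
have := logB_sub_le _ _ _ _ e1 (ltW Tp) TM.
rewrite -/beta -/S.
have rkp : 0 < 1 - rho * k.
  have : 0 <= (1/2 - rho) * k by rewrite mulr_ge0 ?subr_ge0.
  by clear -k1; lra.
have -> : m + k * c - T = k * ((1 - z) * c + z * (rho * c)) by rewrite /T /A /a; ring.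
have := slope_le_slack _ _ _ _ _ _ k0 Tp S0 r0 z0 z1 rkp hnear (ltW hfar).
by rewrite -/a -/A -/T -/rest; clear; lra.
Qed.

(** * Removing a record: ratios and majorant *)

(** The extreme case is [t = m], [s = m + w]. *)
Lemma keep_ratio_le (R : realFieldType) (m w t s L : R) :
  0 < m -> 0 <= w -> m <= t -> 0 < s -> s <= t + w -> w / (m + w) <= L ->
  1 - t / s <= L.
Proof.
move=> m0 w0 mt s0 st; set g := w / (m + w) => gL; apply: le_trans gL.
have gw : g * (m + w) = w by rewrite /g divfK// gt_eqF//; lra.
have g0 : 0 <= g by apply: divr_ge0; lra.
have g1 : g <= 1 by rewrite /g ler_pdivrMr; lra.
clearbody g.
have -> : 1 - t / s = (s - t) / s by field; rewrite gt_eqF.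
rewrite ler_pdivrMr//.
have : 0 <= g * (t - m) by apply: mulr_ge0; lra.
have : 0 <= (1 - g) * (t + w - s) by apply: mulr_ge0; lra.
lra.
Qed.

(** For [t <= 1] the left side decreases in [s], so [s] may be lowered to [v]. *)
Lemma drop_ratio_le (R : realFieldType) (t s v L : R) :
  t <= 1 -> s < 1 -> v <= s -> 0 <= L -> t - v <= L * (1 - v) ->
  1 - (1 - t) / (1 - s) <= L.
Proof.
move=> t1 s1 vs L0 hv.
have -> : 1 - (1 - t) / (1 - s) = (t - s) / (1 - s) by field; rewrite gt_eqF; lra.
rewrite ler_pdivrMr; last lra.
have [L1|L1] := leP L 1.
  have : 0 <= (1 - L) * (s - v) by apply: mulr_ge0; lra.
  lra.
have : 0 <= (L - 1) * (1 - s) by apply: mulr_ge0; lra.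
lra.
Qed.

(** After division by [w], the amount [z / c] links the two terms:
    [(1 - z) / (m + w) + z / c <= 1 / m] and [z / (c - D + w) <= z / c + (1 - lam * z) / (c -
    w)]. *)
Lemma small_min_bound (R : realFieldType) (m c D lam z : R) :
  0 < m -> m <= c -> 0 <= D -> D <= 3/4 * c -> 1/2 <= lam -> lam <= 1 ->
  0 <= z -> z <= 1 ->
  let w := lam * z * D in
  (1 - z) * (w / (m + w)) + z * (w / (c - D + w))
    <= w / m + (1 - lam * z) * (w / (c - w)).
Proof.
move=> m0 mc D0 Dc l0 l1 z0 z1 /=.
have c0 : 0 < c by lra.
have [w wE0] : exists w, w = lam * z * D by exists (lam * z * D).
rewrite -wE0.
have [x xE] : exists x, x = lam * z by exists (lam * z).
have x0 : 0 <= x by rewrite xE mulr_ge0//; lra.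
have xz : x <= z by rewrite xE ler_piMl//; lra.
have zx : z <= 2 * x by have : 0 <= (lam - 1/2) * z by [apply: mulr_ge0; lra]; lra.
have w0 : 0 <= w by rewrite wE0 -xE; apply: mulr_ge0.
have wD : w <= D by rewrite wE0 -xE ler_piMl//; lra.
have -> : (1 - z) * (w / (m + w)) + z * (w / (c - D + w))
  = w * ((1 - z) / (m + w) + z / (c - D + w)) by ring.
have -> : w / m + (1 - lam * z) * (w / (c - w)) = w * (1 / m + (1 - x) / (c - w)).
  by rewrite xE; ring.
apply: ler_wpM2l => //.
have wE : w = x * D by rewrite wE0 xE.
clear wE0 xE l0 l1.
have h1 : (1 - z) / (m + w) <= 1 / m - z / c.
  rewrite ler_pdivrMr; last lra.
  have -> : (1 / m - z / c) * (m + w) = 1 - z * m / c + (w / m - z * w / c).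
    by field; rewrite !gt_eqF.
  have : z * m / c <= z by rewrite ler_pdivrMr// ler_wpM2l.
  have : z * w / c <= w / m.
    rewrite ler_pdivrMr// mulrAC ler_pdivlMr//.
    have : 0 <= (1 - z) * (w * m) by rewrite !mulr_ge0//; lra.
    have : 0 <= w * (c - m) by rewrite !mulr_ge0//; lra.
    lra.
  lra.
have h2 : z / (c - D + w) <= z / c + (1 - x) / (c - w).
  have -> : z / c = z / (c - D + w) - (1 - x) * (z * D / (c * (c - D + w))).
    by rewrite wE; field; rewrite -wE !gt_eqF//; lra.
  suff : (1 - x) * (z * D / (c * (c - D + w))) <= (1 - x) / (c - w) by lra.
  rewrite ler_wpM2l//; first lra.
  have p1 : 0 < c * (c - D + w) by apply: mulr_gt0; lra.
  rewrite ler_pdivrMr// [leRHS]mulrC ler_pdivlMr; last lra.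
  have zxD : z * D <= 2 * w by have : 0 <= (2 * x - z) * D by [apply: mulr_ge0; lra]; lra.
  have q1 : z * D * (c - w) <= z * D * (c - z * D / 2).
    by rewrite ler_wpM2l ?mulr_ge0//; lra.
  have q2 : 0 <= (z * D - c / 2) * (z * D - c / 2) by rewrite -expr2 sqr_ge0.
  have q3 : 0 <= c * (3/4 * c - D) by apply: mulr_ge0; lra.
  have q4 : 0 <= c * (2 * w - z * D) by apply: mulr_ge0; lra.
  have q5 : 0 <= c * c by apply: mulr_ge0; exact: ltW.
  lra.
lra.
Qed.

(** [th] is the distance of a record to the removed one and [s] its score in D'. The bounds on [s]
    by [t + w] and [t - w] express the triangle inequality; the last one holds because the score in
    D is at least [m]. *)
Lemma logB_bound (R : realType) (m M e V lam z : R) :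
  0 < m -> m <= M -> M < 1 -> 1 <= e -> 1/2 <= lam -> lam <= 1 -> 0 <= z -> z <= 1 ->
  (forall p, 0 <= p -> p <= 1 ->
     logA e (m + p * (M - m)) + p * ((M - m) / m)
       + (1 - p) * (p * (M - m) / (1 - m - p * (M - m))) <= V) ->
  logA e (m + (M - m) / 2) + (M - m) / 2 / (1 - M) <= V ->
  logB e M + (M - m) / (1 - m) <= V ->
  let w := lam * z * (M - m) in
  exists alpha beta : R,
    (forall th s, 0 <= th -> th <= 1 -> let t := m + th * (M - m) in
       m <= s -> s <= M -> s <= t + w -> t - w <= s -> lam * m + (1 - lam) * t <= s ->
       1 - t / s <= alpha + beta * th /\ 1 - (1 - t) / (1 - s) <= alpha + beta * th) /\
    logB e (m + w) + (alpha + beta * z) <= V.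
Proof.
move=> m0 mM M1 e1 l0 l1 z0 z1 H1 H2 H3 w.
have [D DE] : exists D, D = M - m by exists (M - m).
have [c cE] : exists c, c = 1 - m by exists (1 - m).
rewrite -DE in H1 H2 H3 w *.
have ME : M = m + D by lra.
have D0 : 0 <= D by lra.
have c0 : 0 < c by lra.
have lz0 : 0 <= lam * z by apply: mulr_ge0 => //; lra.
have lz1 : lam * z <= 1 by rewrite mulr_ile1//; lra.
have lzz : lam * z <= z by rewrite ler_piMl.
have H1' := H1 _ lz0 lz1; rewrite -/w in H1'; clear H1.
have w0 : 0 <= w by apply: mulr_ge0.
have wD : w <= D by rewrite /w ler_piMl.
have wE : w = lam * z * D by [].
clearbody w.
have [k kE] : exists k, k = D / c by exists (D / c).
have kc : k * c = D by rewrite kE divfK// gt_eqF.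
have k0 : 0 <= k by rewrite kE; apply: divr_ge0 => //; exact: ltW.
have k1 : k < 1 by rewrite kE ltr_pdivrMr//; lra.
have cm : 1 - c = m by lra.
have HQ : logA e m + qgain k <= V.
  apply: le_trans H2; have := logA_mid_ge _ _ _ _ e1 c0 k0 k1.
  by rewrite cm kc (_ : c - D = 1 - M)//; lra.
(* The ratio terms never exceed 1, and for [k >= 3/4] the gain of l2 is at least 1. *)
have [k34|k34] := leP (3/4) k.
  exists 1, 0; split.
    move=> th s th0 th1 t ms sM _ _ _; rewrite mul0r addr0.
    have t0 : 0 <= th * D by apply: mulr_ge0.
    have t1 : th * D <= D by rewrite ler_piMl.
    clear -m0 ms sM M1 t0 t1 ME.
    have : 0 <= t / s by apply: divr_ge0; rewrite /t; lra.
    have : 0 <= (1 - t) / (1 - s) by apply: divr_ge0; rewrite /t; lra.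
    by clear; lra.
  have := qgain_ge1 _ _ k34 k1.
  have m1 : m <= 1 by lra.
  have := logB_le_logA _ _ _ e1 (ltW m0) m1.
  have mw : m <= m + w by lra.
  have := logB_homo _ _ _ _ e1 (ltW m0) mw.
  by move: HQ; clear; lra.
have mw0 : 0 < m + w by clear -m0 w0; lra.
have gd : 0 <= w / (m + w) by rewrite divr_ge0// ltW.
have cDw : 0 < c - D + w by clear -w0 M1 ME cm; lra.
have [mh|mh] := leP m (1/2).
  have L1g : 0 <= w / (c - D + w) by rewrite divr_ge0// ltW.
  (* [b] is the maximum of the two fractions and serves as the height of the majorant at
     [th = 1]. *)
  have [b [bE1 bE2]] : exists b, w / (m + w) <= b /\ w / (c - D + w) <= b /\
      (b <= w / (m + w) \/ b <= w / (c - D + w)).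
    have [h|h] := leP (w / (m + w)) (w / (c - D + w)).
      by exists (w / (c - D + w)); split => //; split => //; right.
    by exists (w / (m + w)); split => //; split; [exact: ltW|left].
  exists (w / (m + w)), (b - w / (m + w)); split; last first.
    have Dc : D <= 3/4 * c by rewrite -kc ler_wpM2r ?ltW.
    have mc : m <= c by lra.
    have := small_min_bound _ _ _ _ _ _ m0 mc D0 Dc l0 l1 z0 z1.
    rewrite /= -wE => hs.
    have hB : logB e (m + w) <= logA e (m + w).
      by apply: logB_le_logA; [|exact: ltW|clear -wD ME M1; lra].
    rewrite (_ : lam * z * (D / m) = w / m) -?cE in H1'; last by rewrite wE; ring.
    have h0 : w / (m + w) <= w / m by rewrite ler_wpM2l// lef_pV2 ?posrE// lerDl.
    have h1 : 0 <= (1 - lam * z) * (w / (c - w)).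
      by rewrite mulr_ge0 ?subr_ge0// divr_ge0//; clear -wD ME M1 cm; lra.
    case: bE2 => _ [hb|hb].
      have : 0 <= (w / (m + w) - b) * z by rewrite mulr_ge0 ?subr_ge0.
      by move: H1' h0 h1 hB; clear; lra.
    have : 0 <= (w / (c - D + w) - b) * z by rewrite mulr_ge0 ?subr_ge0.
    by move: H1' hs hB; clear; lra.
  case: bE2 => bE2 _.
  move=> th s th0 th1 t ms sM st ts _.
  have t0 : 0 <= th * D by apply: mulr_ge0.
  have t1 : th * D <= D by rewrite ler_piMl.
  have bth : 0 <= (b - w / (m + w)) * th by rewrite mulr_ge0 ?subr_ge0.
  clear -m0 w0 st ts ms sM M1 ME t0 t1 bth gd bE1 bE2 mh cm th0 th1 D0 mw0 cDw.
  split.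
    by apply: (keep_ratio_le _ _ _ _ _ _ m0 w0 _ _ st); rewrite /t; lra.
  apply: (drop_ratio_le _ _ _ _ _ _ _ ts); rewrite ?/t; try lra.
  have [g gE] : exists g, g = w / (m + w) by eexists.
  rewrite -gE in bE1 bth gd *.
  have ga : w <= g * (c + w).
    rewrite gE mulrAC ler_pdivlMr// ler_wpM2l//; clear -mh cm; lra.
  have ba : w <= b * (c - D + w).
    by rewrite -ler_pdivrMr.
  clear -ga ba th0 th1 bE1 D0 cm.
  (* The claim is quadratic in [th]; [x1], [x3] and [x2] say that its Bernstein coefficients are
     nonnegative. *)
  have x1 : 0 <= (1 - th) * (1 - th) * (g * (c + w) - w) by rewrite !mulr_ge0 ?subr_ge0.
  have x2 : 0 <= th * th * (b * (c - D + w) - w) by rewrite !mulr_ge0 ?subr_ge0.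
  have x3 : 0 <= th * (1 - th) * (g * (c + w) - w + (b * (c - D + w) - w) + (b - g) * D).
    rewrite mulr_ge0 ?mulr_ge0 ?subr_ge0// addr_ge0 ?mulr_ge0 ?subr_ge0//.
    by rewrite addr_ge0 ?subr_ge0.
  rewrite -cm; clear -x1 x2 x3; lra.
have rE : 1 - (1 - lam) = lam by ring.
have r0 : 0 <= 1 - lam by rewrite subr_ge0.
have r1 : 1 - lam <= 1/2 by clear -l0; lra.
have rk : 0 < 1 - (1 - lam) * k.
  have : 0 <= (1/2 - (1 - lam)) * k by rewrite mulr_ge0 ?subr_ge0.
  by clear -k1; lra.
have lp : 0 <= lam by clear -l0; lra.
(* [om] is the ratio term of a deleted record at [t = M] and [s = lam * m + (1 - lam) * M]. *)
have [om omE] : exists om, om = lam * k / (1 - (1 - lam) * k).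
  by exists (lam * k / (1 - (1 - lam) * k)).
have omk : om * (1 - (1 - lam) * k) = lam * k by rewrite omE divfK// gt_eqF.
have om0 : 0 <= om.
  by rewrite omE; apply: divr_ge0; [exact: mulr_ge0|exact: ltW].
have ch : c <= 1/2 by clear -mh cm; lra.
have gom : w / (m + w) <= om.
  rewrite ler_pdivrMr//.
  have wl : w <= lam * k * c.
    have : 0 <= (1 - z) * (lam * (k * c)).
      by rewrite !mulr_ge0 ?subr_ge0// ltW.
    by rewrite wE -kc; clear; lra.
  have oml : lam * k <= om.
    have : 0 <= om * ((1 - lam) * k) by rewrite !mulr_ge0.
    by clear -omk; lra.
  have : 0 <= (om - lam * k) * m by rewrite mulr_ge0 ?subr_ge0// ltW.
  have : 0 <= lam * k * (m - c) by rewrite !mulr_ge0//; clear -ch cm; lra.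
  have : 0 <= om * w by apply: mulr_ge0.
  by clear -wl; lra.
exists (w / (m + w)), (om - w / (m + w)); split; last first.
  have := logB_bound_ge _ c k (1 - lam) z e V c0 ch k0 (ltW k34) r0 r1 z0 z1 e1.
  rewrite /= rE cm kc -omE.
  have -> : z * lam * k * c = w by rewrite -mulrA kc wE; ring.
  rewrite -ME [z * lam]mulrC.
  have -> : c - w = 1 - m - w by rewrite cE.
  have hp : logA e (m + w) + w / m + (1 - lam * z) * (w / (1 - m - w)) <= V.
    by apply: le_trans H1'; rewrite (_ : lam * z * (D / m) = w / m)//; rewrite wE; ring.
  have H3' : logB e M + k <= V by rewrite kE cE.
  move=> /(_ hp HQ H3').
  by clear; lra.
move=> th s th0 th1 t ms sM st _ hs.
have t0 : 0 <= th * D by apply: mulr_ge0.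
have t1 : th * D <= D by rewrite ler_piMl.
have bth : 0 <= (om - w / (m + w)) * th by rewrite mulr_ge0 ?subr_ge0.
clear -m0 w0 st hs ms sM M1 ME t0 t1 bth gd gom mh cm cE th0 th1 D0 r0 lp l1 kc omk om0.
split.
  by apply: (keep_ratio_le _ _ _ _ _ _ m0 w0 _ _ st); rewrite /t; lra.
apply: (drop_ratio_le _ _ _ _ _ _ _ hs); rewrite ?/t; try lra.
have [g gE] : exists g, g = w / (m + w) by eexists.
rewrite -gE in gom bth gd *.
clear t st hs ms sM s gE.
have cD : 0 <= c - D by clear -cm ME M1; lra.
have -> : m + th * D - (lam * m + (1 - lam) * (m + th * D)) = om * th * (c - (1 - lam) * D).
  have -> : om * th * (c - (1 - lam) * D) = th * c * (om * (1 - (1 - lam) * k)).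
    by rewrite -kc; ring.
  by rewrite omk -kc; ring.
have -> : 1 - (lam * m + (1 - lam) * (m + th * D)) = c - (1 - lam) * (th * D).
  by rewrite cE; ring.
have y1 : 0 <= om * th * ((1 - lam) * (D - th * D)).
  by rewrite !mulr_ge0 ?subr_ge0.
have y2 : 0 <= (1 - th) * g * (c - (1 - lam) * (th * D)).
  rewrite !mulr_ge0 ?subr_ge0//.
  have : (1 - lam) * (th * D) <= D.
    by apply: le_trans t1; rewrite ler_piMl// lerBlDr lerDl.
  by clear -cD; lra.
by clear -y1 y2; lra.
Qed.

(** * Adding a record: ratios of the remaining records *)

(** By convexity of [v / x], a line above it at [a] and [b] stays above in between. The weights [p]
    and [q] are not normalized, to avoid division. *)
Lemma convex_interp_le (R : realFieldType) (a b v L0 L1 p q : R) :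
  0 < a -> 0 < b -> 0 <= v -> v <= L0 * a -> v <= L1 * b -> 0 <= p -> 0 <= q ->
  (p + q) * (p + q) * v <= (p * L0 + q * L1) * (p * a + q * b).
Proof.
move=> a0 b0 v0 h0 h1 p0 q0.
have cross : 2 * v <= L0 * b + L1 * a.
  have ab : 0 < a * b by exact: mulr_gt0.
  rewrite -(ler_pM2r ab).
  have e0 : 0 <= (L0 * a - v) * (b * b) by rewrite !mulr_ge0//; lra.
  have e1 : 0 <= (L1 * b - v) * (a * a) by rewrite !mulr_ge0//; lra.
  have e2 : 0 <= v * ((a - b) * (a - b)) by rewrite mulr_ge0// -expr2 sqr_ge0.
  lra.
have e0 : 0 <= p * p * (L0 * a - v) by rewrite !mulr_ge0//; lra.
have e1 : 0 <= q * q * (L1 * b - v) by rewrite !mulr_ge0//; lra.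
have e2 : 0 <= p * q * (L0 * b + L1 * a - 2 * v) by rewrite !mulr_ge0//; lra.
lra.
Qed.

(** The first ratio is largest at [s = m], where it is affine in [u = th * D]. The second is largest
    at the smaller of [t + y] and [m + D]; these meet at the kink [u = D - y], and the bound is
    convex before it and affine after it. *)
Lemma insert_ratio_le (R : realFieldType) (m D y alpha beta th s : R) :
  0 < m -> 0 <= D -> m + D < 1 -> 0 <= y -> y <= D ->
  y / (1 - m - y) <= alpha -> y / (1 - (m + D)) <= alpha + beta * (D - y) ->
  D / m <= alpha + beta * D -> 0 <= th -> th <= 1 ->
  let t := m + th * D in
  m <= s -> s <= m + D -> s <= t + y ->
  t / s - 1 <= alpha + beta * (th * D) /\
  (1 - t) / (1 - s) - 1 <= alpha + beta * (th * D).
Proof.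
move=> m0 D0 D1 y0 yD h0 hq h1 th0 th1 /=.
have [u uE] : exists u, u = th * D by exists (th * D).
rewrite -uE => ms sM sy.
have u0 : 0 <= u by rewrite uE mulr_ge0.
have uD : u <= D by rewrite uE ler_piMl.
rewrite ler_pdivrMr in h0; last lra.
rewrite ler_pdivrMr in hq; last lra.
rewrite ler_pdivrMr// in h1.
have alpha0 : 0 <= alpha by rewrite -(@pmulr_lge0 _ (1 - m - y)); lra.
have L1 : 0 <= alpha + beta * D by rewrite -(@pmulr_lge0 _ m); lra.
have LE : alpha + beta * u = (1 - th) * alpha + th * (alpha + beta * D).
  by rewrite uE; ring.
have L0 : 0 <= alpha + beta * u.
  by rewrite LE; apply: addr_ge0; apply: mulr_ge0; lra.
have sp : 0 < s by lra.
have s1 : 0 < 1 - s by lra.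
split.
  have -> : (m + u) / s - 1 = (m + u - s) / s by field; rewrite gt_eqF.
  rewrite ler_pdivrMr//.
  have : 0 <= (alpha + beta * u) * (s - m) by apply: mulr_ge0; lra.
  have : 0 <= (1 - th) * alpha * m by rewrite !mulr_ge0//; lra.
  have : 0 <= th * ((alpha + beta * D) * m - D) by apply: mulr_ge0; lra.
  by rewrite LE; move: uE ms; clear; lra.
have -> : (1 - (m + u)) / (1 - s) - 1 = (s - (m + u)) / (1 - s) by field; rewrite gt_eqF.
rewrite ler_pdivrMr//.
have [uy|uy] := leP u (D - y).
  suff : y <= (alpha + beta * u) * (1 - m - u - y).
    have : 0 <= (alpha + beta * u) * (m + u + y - s) by apply: mulr_ge0; lra.
    lra.
  have [Dy|Dy] := eqVneq (D - y) 0.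
    have -> : u = 0 by lra.
    by rewrite mulr0 addr0 subr0.
  have Dyp : 0 < D - y by rewrite lt_def Dy; lra.
  rewrite -(ler_pM2l (mulr_gt0 Dyp Dyp)).
  have cy : 0 < 1 - m - y by lra.
  have cM : 0 < 1 - (m + D) by lra.
  have p0 : 0 <= D - y - u by lra.
  have := convex_interp_le _ _ _ _ _ _ _ _ cy cM y0 h0 hq p0 u0.
  rewrite (_ : D - y - u + u = D - y); last by ring.
  rewrite (_ : (D - y - u) * alpha + u * (alpha + beta * (D - y)) =
    (D - y) * (alpha + beta * u)); last by ring.
  rewrite (_ : (D - y - u) * (1 - m - y) + u * (1 - (m + D)) =
    (D - y) * (1 - m - u - y)); last by ring.
  by rewrite mulrACA.
have yp : 0 < y by lra.
suff : (D - u) <= (alpha + beta * u) * (1 - (m + D)).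
  have : 0 <= (alpha + beta * u) * (m + D - s) by apply: mulr_ge0; lra.
  lra.
rewrite -(ler_pM2l yp).
have : 0 <= (D - u) * ((alpha + beta * (D - y)) * (1 - (m + D)) - y).
  by apply: mulr_ge0; lra.
have : 0 <= (y - (D - u)) * (alpha + beta * D) * (1 - (m + D)).
  by rewrite !mulr_ge0//; lra.
lra.
Qed.

(** * Independent thinning of a database *)

(* Expectation of g over the records of D kept when x is deleted with
   probability k x, independently. *)
Fixpoint thin {R : realType} {X : Type} (k : X -> R) (g : seq X -> R) (D : seq X) : R :=
  if D is x :: D' then
    (1 - k x) * thin k (fun C => g (x :: C)) D' + k x * thin k g D'
  else g [::].

Lemma sum_mask_thin (R : realType) (X : Type) (k : X -> R) (D : seq X) (g : seq X -> R) :
  \sum_(b : (size D).-tuple bool)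
     (\prod_(p <- zip b D) (if p.1 then 1 - k p.2 else k p.2)) * g (mask b D)
  = thin k g D.
Proof.
elim: D g => [|x D IH] g.
  rewrite (bigD1 [tuple])//= big_nil mul1r big1 ?addr0// => i.
  by case/negP; apply/eqP; exact: tuple0.
rewrite /= (reindex (fun p : bool * (size D).-tuple bool =>
  [tuple of p.1 :: p.2])) /=; last first.
  exists (fun t => (thead t, [tuple of behead t])) => [[c t] _|t _] /=.
    by rewrite theadE; congr (_, _); apply: val_inj.
  by rewrite -tuple_eta.
rewrite -(pair_bigA _ (fun (c : bool) (t : (size D).-tuple bool) =>
  (\prod_(p <- zip (c :: t) (x :: D)) (if p.1 then 1 - k p.2 else k p.2)) * g (mask (c :: t) (x :: D)))) /=.
rewrite big_bool -!IH !mulr_sumr.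
by congr (_ + _); apply: eq_bigr => t _; rewrite big_cons /= mulrA.
Qed.

Lemma eq_thin (R : realType) (X : Type) (k k' : X -> R) (g h : seq X -> R) (D : seq X) :
  k =1 k' -> g =1 h -> thin k g D = thin k' h D.
Proof.
move=> kk; elim: D g h => [|x D IH] g h gh /=; first exact: gh.
by rewrite kk (IH _ (fun C => h (x :: C))) ?(IH _ h).
Qed.

Lemma thin_perm (R : realType) (X : Type) (k : X -> R) (g : seq X -> R) (D D' : seq X) :
  (forall C C', Permutation.Permutation C C' -> g C = g C') ->
  Permutation.Permutation D D' -> thin k g D = thin k g D'.
Proof.
move=> + DD'; elim: DD' g => {D D'} [|x D D' DD' IH|x y D|D1 D2 D3 _ IH1 _ IH2] g gP //=.
- rewrite (IH g)// (IH (fun C => g (x :: C)))// => C C' CC'.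
  by apply: gP; exact: Permutation.perm_skip.
- rewrite (@eq_thin _ _ k k (fun C => g [:: x, y & C]) (fun C => g [:: y, x & C])) //.
    by ring.
  by move=> C; apply: gP; exact: Permutation.perm_swap.
- by rewrite (IH1 g)// (IH2 g).
Qed.

Lemma thin_affine (R : realType) (X : Type) (k : X -> R) (a b : R)
    (g : seq X -> R) (D : seq X) :
  thin k (fun C => a * g C + b) D = a * thin k g D + b.
Proof. by elim: D g => [//|x D IH] g /=; rewrite !IH; ring. Qed.

Lemma thinD (R : realType) (X : Type) (k : X -> R) (a b : R) (g h : seq X -> R) (D : seq X) :
  thin k (fun C => a * g C + b * h C) D = a * thin k g D + b * thin k h D.
Proof.
elim: D g h => [//|x D IH] g h /=.
by have /= -> := IH (fun C => g (x :: C)) (fun C => h (x :: C)); rewrite IH; ring.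
Qed.

(** The comparison is asked for sub-multisets of [D] only, since the privacy inequality is available
    only inside the domain. *)
Lemma thin_le (R : realType) (X : Type) (k : X -> R) (g h : seq X -> R) (D : seq X) :
  (forall x, 0 <= k x <= 1) ->
  (forall b, g (mask b D) <= h (mask b D)) -> thin k g D <= thin k h D.
Proof.
move=> k01; elim: D g h => [|x D IH] g h gh /=; first exact: (gh [::]).
have /andP[k0 k1] := k01 x.
apply: lerD; apply: ler_wpM2l; rewrite ?subr_ge0//; apply: IH => b.
  exact: (gh (true :: b)).
exact: (gh (false :: b)).
Qed.

Lemma thin_ge0 (R : realType) (X : Type) (k : X -> R) (g : seq X -> R) (D : seq X) :
  (forall x, 0 <= k x <= 1) -> (forall C, 0 <= g C) -> 0 <= thin k g D.
Proof.
move=> k01; elim: D g => [|x D IH] g g0 /=; first exact: g0.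
have /andP[k0 k1] := k01 x.
by apply: addr_ge0; apply: mulr_ge0; rewrite ?subr_ge0//; apply: IH.
Qed.

(** Deletions are independent, so the ratios of the single records multiply. *)
Lemma thin_ratio (R : realType) (X : Type) (k k' r : X -> R) (g : seq X -> R) (D : seq X) :
  (forall x, 0 <= k x <= 1) -> (forall x, 0 <= k' x <= 1) ->
  (forall x, k x <= r x * k' x) -> (forall x, 1 - k x <= r x * (1 - k' x)) ->
  (forall C, 0 <= g C) ->
  thin k g D <= (\prod_(x <- D) r x) * thin k' g D.
Proof.
move=> k01 k01' rk rk'; elim: D g => [|x D IH] g g0 /=; first by rewrite big_nil mul1r.
rewrite big_cons.
set P := \prod_(i <- D) r i in IH *.
have /andP[k0 k1] := k01 x; have /andP[k0' k1'] := k01' x.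
have -> : r x * P * ((1 - k' x) * thin k' (fun C => g (x :: C)) D + k' x * thin k' g D)
  = r x * (1 - k' x) * (P * thin k' (fun C => g (x :: C)) D)
    + r x * k' x * (P * thin k' g D) by ring.
have t0 : 0 <= thin k (fun C => g (x :: C)) D by exact: thin_ge0.
have t0' : 0 <= thin k g D by exact: thin_ge0.
by apply: lerD; apply: ler_pM; rewrite ?subr_ge0//; apply: IH.
Qed.

Lemma perm_out_score (R : realType) (X : Type) (m M : R) (d : X -> X -> R) (D D' : seq X) :
  Permutation.Permutation D D' -> out_score m M d D =1 out_score m M d D'.
Proof.
move=> DD' x; rewrite /out_score.
suff [-> ->] : size D = size D' /\
  \sum_(y <- D) mtrans m M d x y = \sum_(y <- D') mtrans m M d x y by [].
elim: DD' => {D D'} [|z D D' _ [sz sm]|z t D|D1 D2 D3 _ [sz1 sm1] _ [sz2 sm2]] //=.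
- by rewrite sz !big_cons sm.
- by rewrite !big_cons addrCA.
- by rewrite sz1 sm1.
Qed.

Lemma comp_suppE (R : realType) (X : Type) (dT : measure_display) (T : measurableType dT)
  (m M : R) (d : X -> X -> R) (Mech : seq X -> probability T R) (D : seq X) (E : set T) :
  measurable E ->
  comp_supp m M d Mech D E
  = (thin (out_score m M d D) (fun C => fine (Mech C E)) D)%:E.
Proof.
move=> mE; rewrite -sum_mask_thin -sumEFin; apply: eq_bigr => b _.
by rewrite EFinM fineK// fin_num_measure.
Qed.

(** * Exponential bounds and mean distances *)

(** The mixture is the score in D + z, for [p] the score in D. Applied to the complements as well,
    it bounds the ratio of keeping probabilities. *)
Lemma mix_le_exp (R : realType) (lam p t L : R) :
  lam <= 1 -> 0 < p -> t / p - 1 <= L ->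
  lam * p + (1 - lam) * t <= expR ((1 - lam) * L) * p.
Proof.
move=> l1 p0 tL.
have -> : lam * p + (1 - lam) * t = (1 + (1 - lam) * (t / p - 1)) * p.
  by field; rewrite gt_eqF.
rewrite ler_wpM2r ?(ltW p0)//; apply: le_trans (expR_ge1Dx _).
by rewrite lerD2l ler_wpM2l// subr_ge0.
Qed.

(** Solving the mixture for [p] gives [p = (1 + (1 - lam) / lam * (1 - t / q)) * q]. *)
Lemma le_exp_mix (R : realType) (lam p t L : R) :
  0 < lam -> lam <= 1 -> let q := lam * p + (1 - lam) * t in 0 < q -> 1 - t / q <= L ->
  p <= expR ((1 - lam) / lam * L) * q.
Proof.
move=> l0 l1 /=.
have [q qE] : exists q, q = lam * p + (1 - lam) * t by exists (lam * p + (1 - lam) * t).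
rewrite -qE => q0 tL.
have -> : p = (1 + (1 - lam) / lam * (1 - t / q)) * q.
  have -> : t = q * (t / q) by field; rewrite gt_eqF.
  have -> : p = (q - (1 - lam) * t) / lam by rewrite qE; field; rewrite gt_eqF.
  by field; rewrite !gt_eqF.
rewrite ler_wpM2r ?(ltW q0)//; apply: le_trans (expR_ge1Dx _).
by rewrite lerD2l ler_wpM2l// divr_ge0// ?subr_ge0// ltW.
Qed.

Lemma prod_expR_affine (R : realType) (X : Type) (f : X -> R) (h a b : R) (D : seq X) :
  \prod_(x <- D) expR (h * (a + b * f x))
  = expR (h * (a * (size D)%:R + b * \sum_(x <- D) f x)).
Proof.
elim: D => [|x D IH]; first by rewrite !big_nil /= !mulr0 addr0 mulr0 expR0.
by rewrite !big_cons IH -expRD /= -natr1; congr expR; ring.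
Qed.

Definition mean_dist {R : realType} {X : Type} (d : X -> X -> R) (D : seq X) (x : X) : R :=
  (size D)%:R^-1 * \sum_(y <- D) d x y.

Lemma out_scoreE (R : realType) (X : Type) (m M : R) (d : X -> X -> R) (D : seq X) (x : X) :
  (0 < size D)%N -> out_score m M d D x = m + (M - m) * mean_dist d D x.
Proof.
move=> D0; have N0 : (size D)%:R != 0 :> R by rewrite pnatr_eq0 -lt0n.
rewrite /out_score /mean_dist.
have -> : \sum_(y <- D) mtrans m M d x y = m * (size D)%:R + (M - m) * \sum_(y <- D) d x y.
  elim: (D) => [|y s IH]; first by rewrite !big_nil !mulr0 addr0.
  by rewrite !big_cons IH /mtrans /= -natr1; ring.
by field.
Qed.

Lemma mean_dist_cons (R : realType) (X : Type) (d : X -> X -> R) (D : seq X) (z x : X) :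
  (0 < size D)%N -> let lam := (size D)%:R / ((size D)%:R + 1) in
  mean_dist d (z :: D) x = lam * mean_dist d D x + (1 - lam) * d x z.
Proof.
move=> D0 lam; rewrite /mean_dist /lam big_cons /= -natr1.
have N0 : 0 < (size D)%:R :> R by rewrite ltr0n.
by field; rewrite !gt_eqF//; lra.
Qed.

Lemma mean_le (R : realType) (X : Type) (f : X -> R) (D : seq X) (a : R) :
  (0 < size D)%N -> (forall x, f x <= a) -> (size D)%:R^-1 * \sum_(x <- D) f x <= a.
Proof.
move=> D0 fa; rewrite mulrC ler_pdivrMr ?ltr0n//.
elim: (D) => [|x s IH]; first by rewrite big_nil mulr0.
by rewrite big_cons /= -natr1 mulrDr mulr1 addrC lerD.
Qed.

Lemma mean_dist_bounds (R : realType) (X : Type) (d : X -> X -> R) (D : seq X) :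
  is_normalized_distance d -> (0 < size D)%N ->
  (forall x, 0 <= mean_dist d D x <= 1) /\
  (forall x z, mean_dist d D x <= d x z + mean_dist d D z /\
               d x z <= mean_dist d D x + mean_dist d D z).
Proof.
move=> [d01 _ dsym dtri _] D0; split => [x|x z].
  apply/andP; split; last by apply: mean_le => // y; have [] := d01 x y.
  by apply: mulr_ge0; rewrite ?invr_ge0 ?ler0n// sumr_ge0// => y _; have [] := d01 x y.
have N0 : 0 < (size D)%:R :> R by rewrite ltr0n.
have shift (a : R) (f g : X -> R) : (forall y, f y - g y <= a) ->
    (size D)%:R^-1 * \sum_(y <- D) f y <= a + (size D)%:R^-1 * \sum_(y <- D) g y.
  by move=> h; rewrite -lerBlDr -mulrBr -sumrB; exact: mean_le.
split.
  by apply: shift => y; have := dtri x z y; lra.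
suff : (size D)%:R^-1 * \sum_(y <- D) (d x z - d x y - d z y) <= 0.
  have -> : \sum_(y <- D) (d x z - d x y - d z y)
      = d x z * (size D)%:R - \sum_(y <- D) d x y - \sum_(y <- D) d z y.
    elim: (D) => [|y s IH]; first by rewrite !big_nil mulr0 !subr0.
    by rewrite !big_cons IH /= -natr1; ring.
  rewrite !mulrBr -/(mean_dist d D x) -/(mean_dist d D z) mulrC mulfK ?gt_eqF//; lra.
apply: mean_le => // y; have := dtri x y z; rewrite (dsym y z); lra.
Qed.

(** * Transfer of privacy through the suppression *)

(** With [s = k' z], the expectation [G] of [g] under [k'] satisfies [(1 - s) * (e * G + delta) + s
    * G = (e - (e - 1) * s) * G + delta * (1 - s)]. *)
Lemma thin_insert_le (R : realType) (X : Type) (k k' : X -> R) (g : seq X -> R)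
    (D : seq X) (z : X) (m e delta V kap : R) :
  (forall x, 0 <= k x <= 1) -> (forall x, 0 <= k' x <= 1) -> (forall C, 0 <= g C) ->
  m <= k' z -> 1 <= e -> 0 <= delta ->
  thin k' g D <= expR kap * thin k g D ->
  (forall b, g (z :: mask b D) <= e * g (mask b D) + delta) ->
  logA e (k' z) + kap <= V ->
  thin k' g (z :: D) <= expR V * thin k g D + delta * (1 - m).
Proof.
move=> k01 k01' g0 ms e1 delta0 hK hg hV /=.
have /andP[s0 s1] := k01' z; set s := k' z in ms hV s0 s1 *.
have h1 : thin k' (fun C => g (z :: C)) D <= e * thin k' g D + delta.
  by rewrite -thin_affine; exact: thin_le.
have q0 : 0 < e - (e - 1) * s.
  by have : 0 <= (e - 1) * (1 - s) by [apply: mulr_ge0; lra]; lra.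
have G0 : 0 <= thin k g D by exact: thin_ge0.
have qE : (e - (e - 1) * s) * expR kap <= expR V.
  have -> : e - (e - 1) * s = expR (logA e s) by rewrite lnK.
  by rewrite -expRD ler_expR.
have h2 := ler_wpM2l (ltW q0) hK.
have h3 := ler_wpM2r G0 qE.
have s1' : 0 <= 1 - s by lra.
have h4 := ler_wpM2l s1' h1.
have : 0 <= delta * (s - m) by apply: mulr_ge0; lra.
lra.
Qed.

(** Averaging over the fate of [z] gives a function [h] with [h >= a * g - b * (1 - s) * delta],
    where [b = e^-1] and [a = b + (1 - b) * s]. The change from [k] to [k'] is applied to [h], not
    to [g]. *)
Lemma thin_delete_le (R : realType) (X : Type) (k k' : X -> R) (g : seq X -> R)
    (D : seq X) (z : X) (m e delta V kap : R) :
  (forall x, 0 <= k x <= 1) -> (forall x, 0 <= k' x <= 1) -> (forall C, 0 <= g C) ->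
  m <= k' z -> 1 <= e -> 0 <= delta ->
  (forall h : seq X -> R, (forall C, 0 <= h C) -> thin k h D <= expR kap * thin k' h D) ->
  (forall b, g (mask b D) <= e * g (z :: mask b D) + delta) ->
  logB e (k' z) + kap <= V ->
  thin k g D <= expR V * thin k' g (z :: D) + delta * (1 - m).
Proof.
move=> k01 k01' g0 ms e1 delta0 hK hg hV /=.
have /andP[s0 s1] := k01' z; set s := k' z in ms hV s0 s1 *.
have e0 : 0 < e by lra.
have b0 : 0 < e^-1 by rewrite invr_gt0.
have b1 : e^-1 <= 1 by rewrite invf_le1.
have [b bE] : exists b, b = e^-1 by exists e^-1.
have be : b * e = 1 by rewrite bE mulVf// gt_eqF.
pose a := b + (1 - b) * s.
have a0 : 0 < a by rewrite /a; have : 0 <= (1 - b) * s by [apply: mulr_ge0; lra]; lra.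
have aV : a^-1 = expR (logB e s).
  by rewrite /logB -bE expRN lnK// posrE.
pose h C := (1 - s) * g (z :: C) + s * g C.
have h0 C : 0 <= h C by apply: addr_ge0; apply: mulr_ge0 => //; lra.
have hE : thin k' h D = (1 - s) * thin k' (fun C => g (z :: C)) D + s * thin k' g D.
  exact: (thinD _ _ _ _ _ (fun C => g (z :: C)) g).
rewrite -hE; have := hK _ h0.
have : thin k (fun C => a * g C + - (b * (1 - s) * delta)) D <= thin k h D.
  apply: thin_le => // B; rewrite /a /h.
  have : 0 <= (b * (1 - s)) * (e * g (z :: mask B D) + delta - g (mask B D)).
    by apply: mulr_ge0; [apply: mulr_ge0; lra|rewrite subr_ge0].
  have -> : (b * (1 - s)) * (e * g (z :: mask B D) + delta - g (mask B D))
    = (1 - s) * (b * e) * g (z :: mask B D) + b * (1 - s) * delta - b * (1 - s) * g (mask B D).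
    by ring.
  rewrite be; lra.
rewrite thin_affine => h1 h2.
have h3 : a * thin k g D <= expR kap * thin k' h D + b * (1 - s) * delta by lra.
have h4 : expR kap * thin k' h D <= a * (expR V * thin k' h D).
  rewrite mulrA ler_wpM2r//; first exact: thin_ge0.
  by rewrite -ler_pdivrMl// aV -expRD ler_expR.
have h5 : b * (1 - s) * delta <= a * (delta * (1 - m)).
  have ba : b <= a by rewrite /a; have : 0 <= (1 - b) * s by [apply: mulr_ge0; lra]; lra.
  have : 0 <= (a - b) * ((1 - s) * delta).
    by apply: mulr_ge0; [lra|apply: mulr_ge0; lra].
  have : 0 <= a * (delta * (s - m)).
    by apply: mulr_ge0; [exact: ltW|apply: mulr_ge0; lra].
  lra.
rewrite -(ler_pM2l a0); lra.
Qed.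

Lemma suppression_bound (R : realType) (X : Type) (d : X -> X -> R) (m M e delta V : R)
    (g : seq X -> R) (D : seq X) (z : X) :
  is_normalized_distance d -> 0 < m -> m <= M -> M < 1 -> 1 <= e -> 0 <= delta ->
  (forall C, 0 <= g C) ->
  (forall p, 0 <= p -> p <= 1 ->
     logA e (m + p * (M - m)) + p * ((M - m) / m)
       + (1 - p) * (p * (M - m) / (1 - m - p * (M - m))) <= V) ->
  (forall p, 0 <= p -> p <= 1 ->
     logA e (m + (M - m) / (2 - p)) + p * ((M - m) / m)
       + (1 - p) * ((M - m) / (2 - p) / (1 - M)) <= V) ->
  logB e M + (M - m) / (1 - m) <= V ->
  let k := out_score m M d D in let k' := out_score m M d (z :: D) in
  ((forall b, g (z :: mask b D) <= e * g (mask b D) + delta) ->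
   thin k' g (z :: D) <= expR V * thin k g D + delta * (1 - m)) /\
  ((forall b, g (mask b D) <= e * g (z :: mask b D) + delta) ->
   thin k g D <= expR V * thin k' g (z :: D) + delta * (1 - m)).
Proof.
move=> dN m0 mM M1 e1 delta0 g0 H1 H2 H3 k k'.
have [_ d0 dsym _ _] := dN.
have d01 x y : 0 <= d x y <= 1 by have [h _ _ _ _] := dN; apply/andP; exact: h.
have dzz x : d x x = 0 by apply/d0.
have score_bounds D' x : (0 < size D')%N -> m <= out_score m M d D' x <= M.
  move=> D'0; have [+ _] := mean_dist_bounds _ _ _ _ dN D'0 => /(_ x)/andP[q0 q1].
  rewrite out_scoreE//.
  have : 0 <= (M - m) * mean_dist d D' x by apply: mulr_ge0; lra.
  have : 0 <= (M - m) * (1 - mean_dist d D' x) by apply: mulr_ge0; lra.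
  lra.
have k'mM x : m <= k' x <= M by exact: score_bounds.
have k'01 x : 0 <= k' x <= 1 by have /andP[? ?] := k'mM x; apply/andP; split; lra.
(* Empty databases are separate: their mean is a division by zero, with value 0. *)
have [D0|Dp] := posnP (size D).
  rewrite /k /k' (_ : D = [::]); last by case: (D) D0.
  have k01 x : 0 <= out_score m M d [::] x <= 1.
    by rewrite /out_score big_nil mulr0 lexx ler01.
  have k'z : out_score m M d [:: z] z = m.
    by rewrite /out_score big_seq1 /mtrans dzz /= mulr0 addr0 invr1 mul1r.
  have k'01' x : 0 <= out_score m M d [:: z] x <= 1.
    by have /andP[? ?] := score_bounds [:: z] x isT; apply/andP; split; lra.
  have V0 : logA e (out_score m M d [:: z] z) + 0 <= V.
    have := H1 0 (lexx _) ler01; rewrite k'z.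
    by rewrite !mul0r !mulr0 !addr0.
  split => hg.
    apply: (thin_insert_le _ _ _ _ _ [::] _ _ e _ _ 0) => //.
      by rewrite k'z.
    by rewrite expR0 mul1r.
  apply: (thin_delete_le _ _ _ _ _ [::] _ _ e _ _ 0) => //.
  - by rewrite k'z.
  - by move=> h _; rewrite expR0 mul1r.
  - apply: le_trans V0; rewrite lerD2r k'z; apply: logB_le_logA => //; lra.
have kmM x : m <= k x <= M by exact: score_bounds.
have k01 x : 0 <= k x <= 1 by have /andP[? ?] := kmM x; apply/andP; split; lra.
have N1 : 1 <= (size D)%:R :> R by rewrite ler1n.
pose lam : R := (size D)%:R / ((size D)%:R + 1).
(* Summed over D, the exponents [1 - lam] of the single records give [lam] when z is added, and
   [(1 - lam) / lam] gives 1 when z is removed. *)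
have lN : (1 - lam) * (size D)%:R = lam by rewrite /lam; field; rewrite gt_eqF//; lra.
have lh : 1/2 <= lam by rewrite /lam ler_pdivlMr; lra.
have l1 : lam <= 1 by rewrite /lam ler_pdivrMr; lra.
pose zeta := mean_dist d D z.
have [mb mtri] := mean_dist_bounds _ _ _ _ dN Dp.
have /andP[z0 z1] := mb z; rewrite -/zeta in z0 z1.
have mtri' x := mtri x z.
have sumd : \sum_(x <- D) d x z = (size D)%:R * zeta.
  rewrite /zeta /mean_dist mulVKf ?gt_eqF//; last lra.
  by apply: eq_bigr => x _; rewrite dsym.
have kE x : k x = m + (M - m) * mean_dist d D x by exact: out_scoreE.
have k'E x : k' x = lam * k x + (1 - lam) * (m + d x z * (M - m)).
  by rewrite /k' out_scoreE// mean_dist_cons// kE -/lam; ring.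
have k'z : k' z = m + lam * zeta * (M - m) by rewrite k'E kE dzz -/zeta; ring.
have MD : M = m + (M - m) by ring.
have kt x : k x <= m + d x z * (M - m) + zeta * (M - m).
  have [h _] := mtri' x; rewrite kE.
  have : 0 <= (M - m) * (d x z + zeta - mean_dist d D x) by apply: mulr_ge0; rewrite ?/zeta; lra.
  lra.
have tk x : m + d x z * (M - m) - zeta * (M - m) <= k x.
  have [_ h] := mtri' x; rewrite kE.
  have : 0 <= (M - m) * (mean_dist d D x + zeta - d x z) by apply: mulr_ge0; rewrite ?/zeta; lra.
  lra.
have l0 : 0 <= lam by lra.
split => hg.
  have [al [be [c1 c2 c3 c4]]] := logA_bound _ m M e V lam zeta m0 mM M1 e1 l0 l1 z0 z1 H1 H2.
  set y := zeta * (M - m) in c1 c2 c4 kt tk.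
  have y0 : 0 <= y by apply: mulr_ge0; lra.
  have yD : y <= M - m by rewrite /y ler_piMl//; lra.
  apply: (thin_insert_le _ _ _ _ _ _ _ _ e _ _ (lam * (al + be * y))) => //.
  - by have /andP[] := k'mM z.
  - have rat x := insert_ratio_le _ m (M - m) y al be (d x z) (k x) m0.
    have -> : expR (lam * (al + be * y))
        = \prod_(x <- D) expR ((1 - lam) * (al + be * (M - m) * d x z)).
      rewrite (prod_expR_affine _ _ (fun x => d x z)) sumd; congr expR.
      by rewrite -[X in X * (al + _)]lN /y; ring.
    have hr x : [/\ (m + d x z * (M - m)) / k x - 1 <= al + be * (d x z * (M - m)) &
        (1 - (m + d x z * (M - m))) / (1 - k x) - 1 <= al + be * (d x z * (M - m))].
      have /andP[t0 t1] := d01 x z; have /andP[q0 q1] := kmM x.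
      by have [] := rat x _ _ y0 yD c1 _ c3 t0 t1 q0 _ (kt x); rewrite -?MD//; lra.
    apply: thin_ratio => // x; have [r1 r2] := hr x; have /andP[q0 q1] := kmM x.
      rewrite k'E -mulrA [(M - m) * _]mulrC; apply: mix_le_exp => //; lra.
    have -> : 1 - k' x = lam * (1 - k x) + (1 - lam) * (1 - (m + d x z * (M - m))).
      by rewrite k'E; ring.
    rewrite -mulrA [(M - m) * _]mulrC; apply: mix_le_exp => //; lra.
  - by rewrite k'z -mulrA.
have H20 : logA e (m + (M - m) / 2) + (M - m) / 2 / (1 - M) <= V.
  by have := H2 0 (lexx _) ler01; rewrite !subr0 mul0r mul1r addr0.
have [al [be [hr hV]]] := logB_bound _ m M e V lam zeta m0 mM M1 e1 lh l1 z0 z1 H1 H20 H3.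
have lp : 0 < lam by lra.
apply: (thin_delete_le _ _ _ _ _ _ _ _ e _ _ (al + be * zeta)) => //.
- by have /andP[] := k'mM z.
- move=> h h0.
  have -> : expR (al + be * zeta)
      = \prod_(x <- D) expR ((1 - lam) / lam * (al + be * d x z)).
    rewrite (prod_expR_affine _ _ (fun x => d x z)) sumd; congr expR.
    have -> : (1 - lam) / lam * (al * (size D)%:R + be * ((size D)%:R * zeta))
      = (1 - lam) * (size D)%:R / lam * (al + be * zeta) by ring.
    by rewrite lN divff ?mul1r// gt_eqF.
  have hr' x : 1 - (m + d x z * (M - m)) / k' x <= al + be * d x z /\
     1 - (1 - (m + d x z * (M - m))) / (1 - k' x) <= al + be * d x z.
    have /andP[t0 t1] := d01 x z; have /andP[q0 q1] := k'mM x; have /andP[p0 p1] := kmM x.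
    apply: (hr (d x z) (k' x) t0 t1 q0 q1); rewrite k'E.
    + have : 0 <= lam * (m + d x z * (M - m) + zeta * (M - m) - k x).
        by rewrite mulr_ge0 ?subr_ge0.
      by clear; lra.
    + have : 0 <= lam * (k x - (m + d x z * (M - m) - zeta * (M - m))).
        by rewrite mulr_ge0 ?subr_ge0.
      by clear; lra.
    + have : 0 <= lam * (k x - m) by rewrite mulr_ge0 ?subr_ge0.
      by clear; lra.
  apply: thin_ratio => // x; have [r1 r2] := hr' x; have /andP[q0 q1] := k'mM x.
    by move: r1 q0; rewrite k'E => r1 q0; apply: le_exp_mix => //; lra.
  have E1 : 1 - k' x = lam * (1 - k x) + (1 - lam) * (1 - (m + d x z * (M - m))).
    by rewrite k'E; ring.
  have q2 : 0 < 1 - k' x by lra.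
  by move: r2 q2; rewrite E1 => r2 q2; apply: le_exp_mix.
- by rewrite k'z.
Qed.

(** * The functions l1, l2, l3 in terms of [logA] and [logB], and the theorem *)

Lemma l1E (R : realType) (eps m M p : R) :
  0 < m -> m <= M -> M < 1 -> 0 <= p -> p <= 1 ->
  l1 eps m M p = logA (expR eps) (m + p * (M - m)) + p * ((M - m) / m)
    + (1 - p) * (p * (M - m) / (1 - m - p * (M - m))).
Proof.
move=> m0 mM M1 p0 p1; rewrite /l1 /logA.
have -> : p * M + (1 - p) * m = m + p * (M - m) by ring.
have : 0 <= (1 - p) * (M - m) by apply: mulr_ge0; lra.
move=> h; field; rewrite !gt_eqF//; lra.
Qed.

Lemma l2E (R : realType) (eps m M p : R) :
  0 < m -> m <= M -> M < 1 -> 0 <= p -> p <= 1 ->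
  l2 eps m M p = logA (expR eps) (m + (M - m) / (2 - p)) + p * ((M - m) / m)
    + (1 - p) * ((M - m) / (2 - p) / (1 - M)).
Proof.
move=> m0 mM M1 p0 p1; rewrite /l2 /logA.
have -> : p * M + (1 - p) * ((M + m - p * M) / (2 - p)) = m + (M - m) / (2 - p).
  by field; rewrite gt_eqF//; lra.
by field; rewrite !gt_eqF//; lra.
Qed.

Lemma l3E (R : realType) (eps m M : R) : m < 1 ->
  l3 eps m M = logB (expR eps) M + (M - m) / (1 - m).
Proof. by move=> m1; rewrite /l3 /logB expRN; field; rewrite gt_eqF//; lra. Qed.

Theorem theorem3 (R : realType) (X : Type)
  (dT : measure_display) (T : measurableType dT)
  (Dom : seq X -> Prop) (d : X -> X -> R) (m M eps delta : R)
  (Mech : seq X -> probability T R) :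
  (* Dom is a class of multisets, closed under sub-multisets *)
  (forall D D', Permutation.Permutation D D' -> Dom D -> Dom D') ->
  (forall (D : seq X) (b : seq bool), Dom D -> Dom (mask b D)) ->
  (* the mechanism is defined on multisets *)
  (forall D D', Permutation.Permutation D D' -> forall E, Mech D E = Mech D' E) ->
  is_normalized_distance d ->
  0 < m -> m <= M -> M < 1 ->
  0 <= eps -> 0 <= delta ->
  unbounded_DP Dom (fun D E => Mech D E) eps delta ->
  forall V : R,
    (exists2 p, 0 <= p <= 1 & V = lmax eps m M p) ->
    (forall p, 0 <= p <= 1 -> lmax eps m M p <= V) ->
  exists epsS : R,
    `|epsS - V| <= 2 / 10 ^+ 7 /\
    unbounded_DP Dom (comp_supp m M d Mech) epsS (delta * (1 - m)).
Proof.
move=> DomP DomS MechP dN m0 mM M1 eps0 delta0 DP V _ HV.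
exists V; split; first by rewrite subrr normr0 divr_ge0.
have e1 : 1 <= expR eps by rewrite -expR0 ler_expR.
have HV' p : 0 <= p -> p <= 1 -> [/\ l1 eps m M p <= V, l2 eps m M p <= V & l3 eps m M <= V].
  move=> p0 p1; have := HV p; rewrite p0 p1 => /(_ isT).
  by rewrite /lmax !ge_max => /andP[/andP[-> ->] ->].
have H1 p : 0 <= p -> p <= 1 -> logA (expR eps) (m + p * (M - m)) + p * ((M - m) / m)
    + (1 - p) * (p * (M - m) / (1 - m - p * (M - m))) <= V.
  by move=> p0 p1; rewrite -l1E//; have [] := HV' p p0 p1.
have H2 p : 0 <= p -> p <= 1 -> logA (expR eps) (m + (M - m) / (2 - p)) + p * ((M - m) / m)
    + (1 - p) * ((M - m) / (2 - p) / (1 - M)) <= V.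
  by move=> p0 p1; rewrite -l2E//; have [] := HV' p p0 p1.
have H3 : logB (expR eps) M + (M - m) / (1 - m) <= V.
  by rewrite -l3E; [have [] := HV' 0 (lexx _) ler01|lra].
move=> D D' domD domD' nbr E mE; rewrite !comp_suppE//.
set g := fun C => _.
have g0 C : 0 <= g C by apply: fine_ge0; exact: measure_ge0.
have gP C C' : Permutation.Permutation C C' -> g C = g C'.
  by move=> CC'; rewrite /g (MechP C C').
have DPg C C' : Dom C -> Dom C' -> neighbor C C' \/ neighbor C' C ->
    g C <= expR eps * g C' + delta.
  move=> domC domC' CC'; have := DP C C' domC domC' CC' E mE.
  rewrite -(fineK (fin_num_measure (Mech C) E mE)).
  by rewrite -(fineK (fin_num_measure (Mech C') E mE)) -EFinM -EFinD lee_fin.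
(* Permutation invariance allows the additional record to be the head of the list. *)
have permE C C' : Permutation.Permutation C C' ->
    thin (out_score m M d C) g C = thin (out_score m M d C') g C'.
  move=> CC'; rewrite (thin_perm _ _ _ _ _ _ gP CC').
  by apply: eq_thin => //; exact: perm_out_score.
have step C z : Dom (z :: C) -> forall b,
    g (z :: mask b C) <= expR eps * g (mask b C) + delta /\
    g (mask b C) <= expR eps * g (z :: mask b C) + delta.
  move=> domzC b.
  have domz : Dom (z :: mask b C) by exact: (DomS _ (true :: b) domzC).
  have dom : Dom (mask b C) by exact: (DomS _ (false :: b) domzC).
  have nb : neighbor (mask b C) (z :: mask b C).
    by exists z; exact: Permutation.Permutation_refl.
  by split; apply: DPg => //; [right|left].
rewrite -EFinM -EFinD lee_fin.
have main C z := suppression_bound _ _ d m M _ delta V g C z dN m0 mM M1 e1 delta0 g0 H1 H2 H3.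
case: nbr => -[z pz]; rewrite (permE _ _ pz).
  have [_] := main D z; apply => b.
  by have [] := step D z (DomP _ _ pz domD') b.
have [+ _] := main D' z; apply => b.
by have [] := step D' z (DomP _ _ pz domD) b.
Qed.
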